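(* Let $X$ be a connected topological space that has the homotopy type of a countable CW-complex, let $Y$ be an absolute neighborhood retract (ANR), and let $f \colon X \to Y$ be a continuous surjection that is compressive. Then $f$ is a homotopy equivalence.
   Context: A metric space $Y$ is an absolute neighborhood retract (ANR) if, whenever $e \colon Y \to Z$ is an embedding of $Y$ as a closed subset of a metric space $Z$, there are a neighborhood $U \subset Z$ of $e(Y)$ and a retraction $r \colon U \to e(Y)$. Let $f \colon X \to Y$ be a continuous map of topological spaces. A compressive pair for $f$ is a pair $(V',V)$ of open subsets of $Y$ with $V' \subset V$ such that $f^{-1}(V')$ is contractible in $f^{-1}(V)$: there is a continuous $\xi \colon f^{-1}(V') \times [0,1] \to f^{-1}(V)$ such that $\xi(\cdot,0)$ is the identity function of $f^{-1}(V')$ (i.e. $\xi(x,0)=x$) and $\xi(\cdot,1)$ is a constant function. The map $f$ is compressive if it is surjective and, for every $y \in Y$ and every open neighborhood $V \subset Y$ of $y$, there is an open neighborhood $V'$ of $y$ such that $(V',V)$ is a compressive pair for $f$. *)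

(* Defs.v *)
From mathcomp Require Export all_boot all_order all_algebra.
From mathcomp Require Export all_classical all_reals topology.
Export numFieldTopology.Exports.

Set Implicit Arguments.
Unset Strict Implicit.
Unset Printing Implicit Defensive.

Import Order.TTheory GRing.Theory Num.Theory.

Local Open Scope classical_set_scope.
Local Open Scope ring_scope.

Definition embedding (S T : topologicalType) (e : S -> T) : Prop :=
  [/\ injective e, continuous e &
      forall A : set S, open A ->
        exists2 B : set T, open B & e @` A = range e `&` B].

Definition absolute_neighborhood_retract (R : realType) (Y : metricType R)
    : Prop :=
  forall (Z : metricType R) (e : Y -> Z), embedding e -> closed (range e) ->
    exists (U : set Z) (r : Z -> Z),
      [/\ range e `<=` U°, {within U, continuous r}, r @` U `<=` range e
        & forall z, range e z -> r z = z].

Definition homotopic (R : realType) (S T : topologicalType) (f g : S -> T)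
    : Prop :=
  exists H : S * R -> T,
    [/\ {within [set: S] `*` `[0, 1]%classic, continuous H},
        forall x, H (x, 0) = f x & forall x, H (x, 1) = g x].

Definition homotopy_equivalence (R : realType) (S T : topologicalType)
    (f : S -> T) : Prop :=
  continuous f /\
  exists g : T -> S, [/\ continuous g,
    homotopic R (g \o f) idfun & homotopic R (f \o g) idfun].

Definition homotopy_equivalent (R : realType) (S T : topologicalType) : Prop :=
  exists f : S -> T, homotopy_equivalence R f.

(* Euclidean balls and sphere: the library norm on row vectors is the
   sup norm.  In dimension 0 both balls are a point and the sphere is empty. *)
Definition sqnorm (R : realType) (n : nat) (x : 'rV[R]_n) : R :=
  \sum_(i < n) x ord0 i ^+ 2.
Definition disk (R : realType) (n : nat) : set 'rV[R]_n :=
  [set x | sqnorm x <= 1].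
Definition open_disk (R : realType) (n : nat) : set 'rV[R]_n :=
  [set x | sqnorm x < 1].
Definition sphere (R : realType) (n : nat) : set 'rV[R]_n :=
  [set x | sqnorm x = 1].

(* J. H. C. Whitehead's intrinsic description: a Hausdorff space partitioned
   into cells with characteristic maps cw_map, closure finite and carrying the
   weak topology.  Only the values of cw_map i on the closed disk matter. *)
Record cw_structure (R : realType) (K : topologicalType) := CWStructure {
  cw_index : Type;
  cw_dim : cw_index -> nat;
  cw_map : forall i, 'rV[R]_(cw_dim i) -> K;
  cw_cell := fun i => cw_map (i:=i) @` @open_disk R (cw_dim i);
  cw_hausdorff : hausdorff_space K;
  cw_map_continuous :
    forall i, {within @disk R (cw_dim i), continuous (cw_map (i:=i))};
  cw_map_embedding :
    forall i, embedding (fun x : set_type (@open_disk R (cw_dim i)) =>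
                           cw_map (set_val x));
  cw_disjoint : trivIset [set: cw_index] cw_cell;
  cw_cover : \bigcup_i cw_cell i = [set: K];
  cw_closure_finite :
    forall i, exists2 F : set cw_index,
      finite_set F /\ (forall j, F j -> (cw_dim j < cw_dim i)%N) &
      cw_map (i:=i) @` @sphere R (cw_dim i) `<=` \bigcup_(j in F) cw_cell j;
  cw_weak : forall A : set K,
    closed A <-> forall i, closed (A `&` closure (cw_cell i))
}.

Definition countable_cw_complex (R : realType) (K : topologicalType) : Prop :=
  exists c : cw_structure R K, countable [set: cw_index c].

Definition contractible_in (R : realType) (X : topologicalType) (A B : set X)
    : Prop :=
  exists xi : X * R -> X,
    [/\ {within A `*` `[0, 1]%classic, continuous xi},
        xi @` (A `*` `[0, 1]%classic) `<=` B,
        forall x, A x -> xi (x, 0) = x &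
        forall x x', A x -> A x' -> xi (x, 1) = xi (x', 1)].

Definition compressive_pair (R : realType) (X Y : topologicalType) (f : X -> Y)
    (V' V : set Y) : Prop :=
  [/\ open V', open V, V' `<=` V &
      contractible_in R (f @^-1` V') (f @^-1` V)].

Definition compressive (R : realType) (X Y : topologicalType) (f : X -> Y)
    : Prop :=
  set_surj [set: X] [set: Y] f /\
  forall (y : Y) (V : set Y), open_nbhs y V ->
    exists2 V' : set Y, open_nbhs y V' & compressive_pair R f V' V.

(* Main.v *)
Require Import Defs.
From HB Require Import structures.
From mathcomp Require Import finmap wochoice normedtype sequences realfun.
From mathcomp Require Import ring lra.
Import numFieldNormedType.Exports.

(** The map [f] induces bijections on the relevant sets of homotopy classes.
    Surjectivity: there is [g : Y -> X] with [f \o g] homotopic to the identity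
    ([homotopy_section]).  Injectivity: two maps from a CW complex [K] into [X]
    whose composites with [f] are homotopic are homotopic ([homotopic_lift]).
    If [al : X -> K] and [be : K -> X] are homotopy inverse to each other, then
    [g \o f \o be] and [be] have homotopic composites with [f], hence are
    homotopic, and [g \o f] is homotopic to [g \o f \o be \o al], to
    [be \o al] and to the identity.

    Both halves lift a map [phi] into [Y] through [f], up to a homotopy that is
    fixed where a lift is already given.  On one cube ([cube_extension]) the
    argument is local: where [phi] varies little and the lift on the boundary
    stays over a small open set [V'], the contraction of the preimage of [V']
    inside the preimage of [V] fills the cube ([contractible_cone]).  A cube of
    any size is cut into small ones; the faces along the cuts are lifted first,
    precisely enough for the pieces on both sides ([approx_liftP]).  The lift so obtained is only close to [phi] after
    composition with [f]; but close maps into an absolute neighborhood retract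
    are homotopic, by a homotopy that does not move the points where they agree
    ([locally_equiconnected]).  Since the homotopies are kept as part of the
    lift, no precision has to be shared between different cells, and complexes
    of infinite dimension can be treated skeleton by skeleton
    ([cell_extension]).

    Injectivity is this lifting for the cells of [K] multiplied by the interval,
    the lift being given over the two ends.  For surjectivity, [Y] is
    paracompact ([metric_bumps]), so it maps to the cubical nerve of a cover by
    small balls ([ncell]); taking barycentres of the centres of the balls in a
    convex set of functions on [Y] and retracting maps the nerve back to [Y],
    and the composite [Y -> Y] is homotopic to the identity.  Lifting the map
    from the nerve to [Y] and composing with [Y -> nerve] gives [g].

    The convex set consists of the functions [F] on [Y] with
    [|F w - F w'| <= d w w' <= F w + F w'] which vanish somewhere or are bounded
    below by a positive constant; [Y] embeds in it as a closed subset through its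
    distance functions ([kembed_closed]). *)
Set Implicit Arguments.
Unset Strict Implicit.
Unset Printing Implicit Defensive.
Import Order.TTheory GRing.Theory Num.Theory.
Local Open Scope classical_set_scope.
Local Open Scope ring_scope.

(** * Continuity on subsets *)

(** Continuity on [A] in terms of the neighborhoods of the ambient space: one
    function can then be compared on different subsets without changing the type
    of its argument. *)
Definition cont_on (S T : topologicalType) (A : set S) (f : S -> T) :=
  forall x, A x -> forall O, nbhs (f x) O -> \forall y \near x, A y -> O (f y).

Lemma cont_on_cvg (S T : topologicalType) (A : set S) (f : S -> T) :
  cont_on A f <-> forall x, A x -> f @ within A (nbhs x) --> f x.
Proof. by []. Qed.

Lemma cont_onP (S T : topologicalType) (A : set S) (f : S -> T) :
  cont_on A f <-> {within A, continuous f}.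
Proof. by split=> [h|/subspace_continuousP//]; apply/subspace_continuousP. Qed.

Lemma cont_onT (S T : topologicalType) (A : set S) (f : S -> T) :
  continuous f -> cont_on A f.
Proof. by move=> cf; apply/cont_onP; exact: continuous_subspaceT. Qed.

Lemma cont_onTE (S T : topologicalType) (f : S -> T) :
  cont_on setT f <-> continuous f.
Proof.
split=> [cf x O Of|]; last exact: cont_onT.
by have := cf x I O Of; apply: filterS => y; exact.
Qed.

Lemma cont_onS (S T : topologicalType) (A B : set S) (f : S -> T) :
  A `<=` B -> cont_on B f -> cont_on A f.
Proof.
move=> AB cf x Ax O /(cf x (AB x Ax)).
by apply: filterS => y h Ay; apply: h; exact: AB.
Qed.

Lemma cont_on_eq (S T : topologicalType) (A : set S) (f g : S -> T) :
  (forall x, A x -> f x = g x) -> cont_on A f -> cont_on A g.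
Proof.
move=> fg cf x Ax O; rewrite -fg// => /(cf x Ax).
by apply: filterS => y h Ay; rewrite /= -fg//; exact: h.
Qed.

Lemma cont_on_comp (S T U : topologicalType) (A : set S) (B : set T)
    (f : S -> T) (g : T -> U) :
  cont_on A f -> (forall x, A x -> B (f x)) -> cont_on B g ->
  cont_on A (fun x => g (f x)).
Proof.
move=> cf AB cg x Ax O /(cg _ (AB x Ax)) /(cf x Ax).
by apply: filterS => y h Ay; apply: h => //; exact: AB.
Qed.

Lemma cont_on_pair (S T U : topologicalType) (A : set S) (f : S -> T)
    (g : S -> U) :
  cont_on A f -> cont_on A g -> cont_on A (fun x => (f x, g x)).
Proof.
move=> /cont_on_cvg cf /cont_on_cvg cg; apply/cont_on_cvg => x Ax.
by apply: cvg_pair; [exact: cf|exact: cg].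
Qed.

Lemma cont_on_cst (S T : topologicalType) (A : set S) (c : T) :
  cont_on A (fun=> c).
Proof. by apply: cont_onT => x; exact: cvg_cst. Qed.

Lemma cont_on_id (S : topologicalType) (A : set S) : cont_on A id.
Proof. by apply: cont_onT => x. Qed.

Lemma cont_on_fst (S T : topologicalType) (A : set (S * T)) :
  cont_on A fst.
Proof. by apply: cont_onT => x; exact: cvg_fst. Qed.

Lemma cont_on_snd (S T : topologicalType) (A : set (S * T)) :
  cont_on A snd.
Proof. by apply: cont_onT => x; exact: cvg_snd. Qed.

Lemma near_finite_set (S : topologicalType) (I : Type) (F : set I) (x : S)
    (P : I -> S -> Prop) :
  finite_set F -> (forall i, F i -> \forall y \near x, P i y) ->
  \forall y \near x, forall i, F i -> P i y.
Proof.
elim/Pchoice: I => I in F P *.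
move=> /finite_setP[n]; elim: n F => [|n IH] F.
  by rewrite II0 card_eq0 => /eqP -> _; near=> y => i.
move=> /eq_cardSP[i Fi] /IH Fn h.
have : \forall y \near x, forall j, (F `\ i) j -> P j y.
  by apply: Fn => j [Fj _]; exact: h.
move: (h i Fi); apply: filterS2 => y Pi Pj j Fj.
by have [->//|ji] := pselect (j = i); apply: Pj; split.
Unshelve. all: by end_near. Qed.

(** The cover need only be finite near each point: a member that does not
    contain the point is closed, hence misses a neighborhood of it. *)
Lemma cont_on_glue (S T : topologicalType) (I : Type) (D : set S)
    (A : I -> set S) (f : S -> T) :
  (forall x, D x -> exists F : set I, [/\ finite_set F,
    forall i, F i -> closed (A i) /\ cont_on (D `&` A i) f &
    \forall y \near x, D y -> exists2 i, F i & A i y]) ->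
  cont_on D f.
Proof.
move=> loc x Dx O Of; have [F [finF cF nF]] := loc x Dx.
have nO : \forall y \near x, forall i, F i -> A i y -> D y -> O (f y).
  apply: near_finite_set => // i Fi; have [cA cf] := cF i Fi.
  have [Aix|nAix] := pselect (A i x).
    by have := cf x (conj Dx Aix) O Of; apply: filterS => y h Ay Dy; exact: h.
  have : nbhs x (~` A i) by apply: open_nbhs_nbhs; split=> //; exact: closed_openC.
  by apply: filterS.
move: nF nO; apply: filterS2 => y h1 h2 Dy.
by have [i Fi Aiy] := h1 Dy; exact: (h2 i).
Qed.

Lemma cont_on_glue2 (S T : topologicalType) (D A B : set S) (f : S -> T) :
  closed A -> closed B -> D `<=` A `|` B ->
  cont_on (D `&` A) f -> cont_on (D `&` B) f -> cont_on D f.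
Proof.
move=> cA cB DAB fA fB.
apply: (@cont_on_glue _ _ bool D (fun b => if b then A else B)) => x _.
exists setT; split=> //; first by case.
apply: nearW => y Dy.
by case: (DAB y Dy) => h; [exists true|exists false].
Qed.

Lemma hausdorff_prod (S T : topologicalType) :
  hausdorff_space S -> hausdorff_space T -> hausdorff_space (S * T)%type.
Proof.
move=> hS hT p q cl; apply: injective_projections.
  apply: hS => B B' Bp Bq.
  have Bp1 : nbhs p (fst @^-1` B) by exact: (cvg_fst Bp).
  have Bq1 : nbhs q (fst @^-1` B') by exact: (cvg_fst Bq).
  by have [x [? ?]] := cl _ _ Bp1 Bq1; exists x.1.
apply: hT => B B' Bp Bq.
have Bp1 : nbhs p (snd @^-1` B) by exact: (cvg_snd Bp).
have Bq1 : nbhs q (snd @^-1` B') by exact: (cvg_snd Bq).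
by have [x [? ?]] := cl _ _ Bp1 Bq1; exists x.2.
Qed.

Lemma compact_preimage (S T : topologicalType) (C : set S) (B : set T)
    (F : S -> T) :
  compact C -> cont_on C F -> closed B -> compact (C `&` F @^-1` B).
Proof.
move=> cC /cont_onP cF cB.
have /closed_subspaceP[V cV VC] : closed (F @^-1` B : set (subspace C)).
  by move/continuous_closedP : cF; exact.
have := compact_closedI cC cV.
by rewrite setIC VC setIC.
Qed.

(** A closed map argument: a continuous surjection from a compact set onto a
    subset of a Hausdorff space is a quotient map. *)
Lemma cont_on_image (S T U : topologicalType) (C : set S) (q : S -> T)
    (f : T -> U) :
  hausdorff_space T -> compact C -> cont_on C q ->
  cont_on C (fun x => f (q x)) -> cont_on (q @` C) f.
Proof.
move=> hT cC cq cfq _ [x Cx <-] O; rewrite nbhsE => -[O' [oO' O'x] O'O].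
pose D := C `&` (fun x => f (q x)) @^-1` (~` O').
have cD : closed (q @` D).
  apply: compact_closed => //; apply: continuous_compact.
    by apply/cont_onP; apply: cont_onS cq => y [].
  by apply: compact_preimage => //; exact: open_closedC.
have : nbhs (q x) (~` (q @` D)).
  apply: open_nbhs_nbhs; split; first exact: closed_openC.
  by move=> [y [_ nO] yx]; apply: nO; rewrite /= yx.
apply: filterS => z nz [y Cy yz]; apply: O'O; apply: contrapT => nO.
by apply: nz; exists y => //; split=> //=; rewrite yz.
Qed.

Lemma cont_on_metric (R : realType) (S : topologicalType) (Y : metricType R)
    (A : set S) (f : S -> Y) :
  (forall x, A x -> forall e, 0 < e ->
     \forall x' \near x, A x' -> mdist (f x) (f x') < e) -> cont_on A f.
Proof.
move=> h x Ax O /nbhs_ballP[e e0 eO]; have := h x Ax e e0.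
by apply: filterS => x' h' Ax'; apply: eO; rewrite ballEmdist; exact: h'.
Qed.

(** * Real-valued functions *)

Section RealCont.
Context (R : realType) (S : topologicalType) (A : set S).
Implicit Types f g : S -> R.

Lemma cont_on_add f g : cont_on A f -> cont_on A g -> cont_on A (fun x => f x + g x).
Proof.
move=> /cont_on_cvg cf /cont_on_cvg cg; apply/cont_on_cvg => x Ax.
by apply: cvgD; [exact: cf|exact: cg].
Qed.

Lemma cont_on_opp f : cont_on A f -> cont_on A (fun x => - f x).
Proof.
move=> /cont_on_cvg cf; apply/cont_on_cvg => x Ax.
by apply: cvgN; exact: cf.
Qed.

Lemma cont_on_sub f g : cont_on A f -> cont_on A g -> cont_on A (fun x => f x - g x).
Proof. by move=> cf cg; apply: cont_on_add => //; exact: cont_on_opp. Qed.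

Lemma cont_on_mul f g : cont_on A f -> cont_on A g -> cont_on A (fun x => f x * g x).
Proof.
move=> /cont_on_cvg cf /cont_on_cvg cg; apply/cont_on_cvg => x Ax.
by apply: cvgM; [exact: cf|exact: cg].
Qed.

Lemma cont_on_inv f : cont_on A f -> (forall x, A x -> f x != 0) ->
  cont_on A (fun x => (f x)^-1).
Proof.
move=> /cont_on_cvg cf f0; apply/cont_on_cvg => x Ax.
by apply: cvgV; [exact: f0|exact: cf].
Qed.

Lemma cont_on_abs f : cont_on A f -> cont_on A (fun x => `|f x|).
Proof.
move=> /cont_on_cvg cf; apply/cont_on_cvg => x Ax.
by apply: cvg_norm; exact: cf.
Qed.

Lemma cont_on_max f g : cont_on A f -> cont_on A g ->
  cont_on A (fun x => Num.max (f x) (g x)).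
Proof.
move=> cf cg; have : cont_on A (fun x => (f x + g x + `|f x - g x|) / 2).
  apply: cont_on_mul; last exact: cont_on_cst.
  apply: cont_on_add; first exact: cont_on_add.
  by apply: cont_on_abs; exact: cont_on_sub.
apply: cont_on_eq => x _; rewrite /Num.max; case: ltP => h.
  by rewrite ltr0_norm ?subr_lt0//; lra.
by rewrite ger0_norm ?subr_ge0//; lra.
Qed.

Lemma cont_on_bigmax (I : Type) (s : seq I) (F : I -> S -> R) :
  (forall i, cont_on A (F i)) -> cont_on A (fun x => \big[Num.max/0]_(i <- s) F i x).
Proof.
move=> cF; elim: s => [|i s IH].
  by under eq_fun do rewrite big_nil; exact: cont_on_cst.
by under eq_fun do rewrite big_cons; exact: cont_on_max.
Qed.

Lemma cont_on_bigprod (I : Type) (s : seq I) (P : pred I) (F : I -> S -> R) :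
  (forall i, cont_on A (F i)) -> cont_on A (fun x => \prod_(i <- s | P i) F i x).
Proof.
move=> cF; elim: s => [|i s IH].
  by under eq_fun do rewrite big_nil; exact: cont_on_cst.
under eq_fun do rewrite big_cons; case: (P i) => //.
exact: cont_on_mul.
Qed.

Lemma cont_on_sum (I : Type) (s : seq I) (F : I -> S -> R) :
  (forall i, cont_on A (F i)) -> cont_on A (fun x => \sum_(i <- s) F i x).
Proof.
move=> cF; elim: s => [|i s IH].
  by under eq_fun do rewrite big_nil; exact: cont_on_cst.
by under eq_fun do rewrite big_cons; exact: cont_on_add.
Qed.

End RealCont.

Lemma closed_le_fun (R : realType) (S : topologicalType) (f g : S -> R) :
  cont_on setT f -> cont_on setT g -> closed [set x | f x <= g x].
Proof.
move=> cf cg; rewrite [X in closed X](_ : _ = (fun x => g x - f x) @^-1` [set y | 0 <= y]).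
  apply: closed_comp; last exact: closed_ge.
  by move=> x _; apply: (cont_onTE _).1; exact: cont_on_sub.
by apply/seteqP; split => x /=; rewrite subr_ge0.
Qed.

Lemma closed_eq_fun (R : realType) (S : topologicalType) (f g : S -> R) :
  cont_on setT f -> cont_on setT g -> closed [set x | f x = g x].
Proof.
move=> cf cg; rewrite [X in closed X](_ : _ = [set x | f x <= g x] `&` [set x | g x <= f x]).
  by apply: closedI; exact: closed_le_fun.
apply/seteqP; split => x /=; first by move=> ->.
by move=> [h1 h2]; apply/eqP; rewrite eq_le h1 h2.
Qed.

(** * Homotopies *)

Definition unit_itv (R : realType) : set R := [set t | 0 <= t <= 1].

Lemma unit_itvE (R : realType) : `[0, 1]%classic = @unit_itv R.
Proof. by apply/seteqP; split => t /=; rewrite in_itv. Qed.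

(** The relation [homotopic], with continuity expressed by [cont_on]. *)
Definition homotopicI (R : realType) (S T : topologicalType) (u v : S -> T) :=
  exists H : S * R -> T, [/\ cont_on (setT `*` @unit_itv R) H,
    forall x, H (x, 0) = u x & forall x, H (x, 1) = v x].

Lemma homotopicIE (R : realType) (S T : topologicalType) (u v : S -> T) :
  homotopic R u v <-> homotopicI R u v.
Proof.
split=> -[H [cH H0 H1]]; exists H; split=> //.
  by apply/cont_onP; rewrite -unit_itvE.
by move/cont_onP : cH; rewrite -unit_itvE.
Qed.

Section HomotopyCalculus.
Context (R : realType).

Lemma homotopicI_sym (S T : topologicalType) (u v : S -> T) :
  homotopicI R u v -> homotopicI R v u.
Proof.
move=> [H [cH H0 H1]]; exists (fun p => H (p.1, 1 - p.2)); split.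
- apply: (@cont_on_comp _ _ _ _ (setT `*` @unit_itv R)
    (fun p : S * R => (p.1, 1 - p.2)) H) => //.
    apply: cont_on_pair; first exact: cont_on_fst.
    by apply: cont_on_sub; [exact: cont_on_cst|exact: cont_on_snd].
  by move=> [x t] [_ /= /andP[? ?]]; split=> //; apply/andP; split; lra.
- by move=> x; rewrite subr0 H1.
- by move=> x; rewrite subrr H0.
Qed.

Lemma homotopicI_trans (S T : topologicalType) (v u w : S -> T) :
  homotopicI R u v -> homotopicI R v w -> homotopicI R u w.
Proof.
move=> [H [cH H0 H1]] [H' [cH' H'0 H'1]].
exists (fun p => if p.2 <= 1 / 2 then H (p.1, 2 * p.2) else H' (p.1, 2 * p.2 - 1)); split.
- apply: (@cont_on_glue2 _ _ _ [set p : S * R | p.2 <= 1 / 2] [set p : S * R | 1 / 2 <= p.2]).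
  + by apply: closed_le_fun; [exact: cont_on_snd|exact: cont_on_cst].
  + by apply: closed_le_fun; [exact: cont_on_cst|exact: cont_on_snd].
  + by move=> p _ /=; have [|/ltW] := leP p.2 (1 / 2); [left|right].
  + apply: (@cont_on_eq _ _ _ (fun p : S * R => H (p.1, 2 * p.2))).
      by move=> p [_ /= ->].
    apply: (@cont_on_comp _ _ _ _ (setT `*` @unit_itv R)
      (fun p : S * R => (p.1, 2 * p.2)) H) => //.
      apply: cont_on_pair; first exact: cont_on_fst.
      by apply: cont_on_mul; [exact: cont_on_cst|exact: cont_on_snd].
    by move=> [x t] [[_ /= /andP[? ?]] /= ?]; split=> //; apply/andP; split; rewrite /=; lra.
  + apply: (@cont_on_eq _ _ _ (fun p : S * R => H' (p.1, 2 * p.2 - 1))).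
      move=> [x t] [_ /= h]; case: ifP => // h'.
      have -> : t = 1 / 2 by apply/eqP; rewrite eq_le h'.
      rewrite (_ : 2 * (1 / 2) - 1 = 0); last by lra.
      by rewrite (_ : 2 * (1 / 2) = 1) ?H1 ?H'0//; lra.
    apply: (@cont_on_comp _ _ _ _ (setT `*` @unit_itv R)
      (fun p : S * R => (p.1, 2 * p.2 - 1)) H') => //.
      apply: cont_on_pair; first exact: cont_on_fst.
      apply: cont_on_sub; last exact: cont_on_cst.
      by apply: cont_on_mul; [exact: cont_on_cst|exact: cont_on_snd].
    by move=> [x t] [[_ /= /andP[? ?]] /= ?]; split=> //; apply/andP; split; rewrite /=; lra.
- by move=> x /=; rewrite ifT ?mulr0 ?H0//; lra.
- move=> x /=; rewrite ifF; last by apply/negbTE; rewrite -ltNge; lra.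
  by rewrite (_ : 2 * 1 - 1 = 1) ?H'1//; lra.
Qed.

Lemma homotopicI_precomp (S' S T : topologicalType) (a : S' -> S) (u v : S -> T) :
  continuous a -> homotopicI R u v ->
  homotopicI R (fun x => u (a x)) (fun x => v (a x)).
Proof.
move=> ca [H [cH H0 H1]]; exists (fun p => H (a p.1, p.2)); split=> [|x|x] //.
apply: (@cont_on_comp _ _ _ _ (setT `*` @unit_itv R)
  (fun p : S' * R => (a p.1, p.2)) H) => //.
  apply: cont_on_pair; last exact: cont_on_snd.
  apply: (@cont_on_comp _ _ _ _ setT fst a) => //; first exact: cont_on_fst.
  exact: cont_onT.
Qed.

Lemma homotopicI_postcomp (S T T' : topologicalType) (b : T -> T') (u v : S -> T) :
  continuous b -> homotopicI R u v ->
  homotopicI R (fun x => b (u x)) (fun x => b (v x)).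
Proof.
move=> cb [H [cH H0 H1]]; exists (fun p => b (H p)); split=> [|x|x].
- by apply: (@cont_on_comp _ _ _ _ setT H b) => //; exact: cont_onT.
- by rewrite H0.
- by rewrite H1.
Qed.

End HomotopyCalculus.

(** * Absolute neighborhood retracts and Katetov functions *)

(** The inequalities say that [F] is the distance to a point added to [Y].  The
    last clause excludes the points of the completion of [Y] that are not in [Y]:
    with it, the distance functions form a closed set even if [Y] is not
    complete. *)
Definition katetov (R : realType) (Y : metricType R) (F : Y -> R) :=
  (forall w w', F w - F w' <= mdist w w' /\ mdist w w' <= F w + F w') /\
  ((exists y, F y = 0) \/ (exists2 e, 0 < e & forall w, e <= F w)).

Lemma katetov_mdist (R : realType) (Y : metricType R) (y : Y) :
  katetov (mdist y).
Proof.
split; last by left; exists y; rewrite mdistxx.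
move=> w w'; split.
  by rewrite lerBlDr (metric_sym w w') addrC; exact: metric_triangle.
by rewrite (metric_sym y w); exact: metric_triangle.
Qed.

Lemma katetov_ge0 (R : realType) (Y : metricType R) (F : Y -> R) w :
  katetov F -> 0 <= F w.
Proof. by move=> [h _]; have [_] := h w w; rewrite mdistxx; lra. Qed.

Lemma katetov_zero (R : realType) (Y : metricType R) (F : Y -> R) y :
  katetov F -> F y = 0 -> F = mdist y.
Proof.
move=> [h _] Fy; apply/funext => w; apply/eqP; rewrite eq_le.
have [h1 _] := h w y; have [_ h2] := h y w.
by rewrite metric_sym in h1; apply/andP; split; lra.
Qed.

(** Neighborhood retractions are available in metric spaces only, so the
    Katetov functions are made into one, with the distance of uniform
    convergence.  The functions themselves are unbounded, but the difference of
    two of them is bounded. *)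
Record kspace (R : realType) (Y : metricType R) :=
  KSpace { kfun :> Y -> R ; kfunP : katetov kfun }.

Section KSpace.
Context (R : realType) (Y : metricType R).
Local Notation Z := (kspace Y).

HB.instance Definition _ := gen_eqMixin Z.
HB.instance Definition _ := gen_choiceMixin Z.

Definition kdist (F G : Z) : R := sup (range (fun w => `|F w - G w|)).

Lemma kspace_eq (F G : Z) : (forall w, F w = G w) -> F = G.
Proof.
case: F G => F hF [G hG] /= /funext FG; subst G.
by congr KSpace; exact: Prop_irrelevance.
Qed.

Lemma kdist_le (F G : Z) e : 0 <= e -> (forall w, `|F w - G w| <= e) ->
  kdist F G <= e.
Proof.
move=> e0 h; rewrite /kdist; have [->|ne] := eqVneq (range (fun w => `|F w - G w|)) set0.
  by rewrite sup0.
by apply: ge_sup; [exact/set0P|move=> _ [w _ <-]].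
Qed.

Lemma kdist_ub (F G : Z) w : `|F w - G w| <= kdist F G.
Proof.
apply: ub_le_sup; last by exists w.
exists (F w + G w) => _ [w' _ <-].
have [f1 f2] := (kfunP F).1 w' w; have [g1 g2] := (kfunP G).1 w' w.
by rewrite ler_norml; apply/andP; split; lra.
Qed.

Lemma kdist_ge0 (F G : Z) : 0 <= kdist F G.
Proof.
rewrite /kdist; have [->|/set0P[_ [w _ _]]] := eqVneq (range (fun w => `|F w - G w|)) set0.
  by rewrite sup0.
by apply: le_trans (kdist_ub F G w).
Qed.

Lemma kdistxx (F : Z) : kdist F F = 0.
Proof.
apply/eqP; rewrite eq_le kdist_ge0 andbT; apply: kdist_le => // w.
by rewrite subrr normr0.
Qed.

Lemma kdist_pos (F G : Z) : kdist F G = 0 -> F = G.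
Proof.
move=> FG; apply: kspace_eq => w; have := kdist_ub F G w; rewrite FG => h.
by apply/eqP; rewrite -subr_eq0 -normr_le0.
Qed.

Lemma kdist_sym (F G : Z) : kdist F G = kdist G F.
Proof. by congr sup; congr image; apply/funext => w; rewrite distrC. Qed.

Lemma kdist_triangle (G F H : Z) : kdist F H <= kdist F G + kdist G H.
Proof.
apply: kdist_le => [|w]; first by rewrite addr_ge0// kdist_ge0.
rewrite (le_trans (ler_distD (G w) _ _))// lerD//; exact: kdist_ub.
Qed.

HB.instance Definition _ :=
  @isMetric.Build R Z kdist kdistxx kdist_pos kdist_sym kdist_triangle.

Definition kembed (y : Y) : Z := KSpace (katetov_mdist y).

Lemma kdist_kembed (y y' : Y) : kdist (kembed y) (kembed y') = mdist y y'.
Proof.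
apply/eqP; rewrite eq_le; apply/andP; split.
  apply: kdist_le => [|w] /=; first exact: mdist_ge0.
  have := metric_triangle y y' w; have := metric_triangle y' y w.
  by rewrite (metric_sym y' y) ler_norml => ? ?; apply/andP; split; lra.
have := kdist_ub (kembed y) (kembed y') y' => /=.
by rewrite mdistxx subr0 ger0_norm// mdist_ge0.
Qed.

Lemma kspace_ball (F G : Z) e : ball F e G <-> kdist F G < e.
Proof. by rewrite ballEmdist. Qed.

End KSpace.

Lemma kembed_embedding (R : realType) (Y : metricType R) :
  embedding (@kembed R Y).
Proof.
have inj : injective (@kembed R Y).
  move=> y y' yy'; apply: mdist_positivity.
  by rewrite -kdist_kembed yy' kdistxx.
split=> // [y|A oA].
  apply/metricType_numDomainType.cvgrPdist_lt => e e0.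
  have : nbhs y (ball y e) by exact: nbhsx_ballx.
  by apply: filterS => y'; rewrite ballEmdist /= -kdist_kembed.
exists (\bigcup_(p in [set p : Y * R | 0 < p.2 /\ ball p.1 p.2 `<=` A])
   (ball (kembed p.1) p.2)°).
  by apply: bigcup_open => p _; exact: open_interior.
apply/seteqP; split=> [_ [y Ay <-]|_ [[y _ <-] [[y' e] [/= e0 yA]]]].
  split; first by exists y.
  have /nbhs_ballP[e e0 yA] : nbhs y A by exact: open_nbhs_nbhs.
  exists (y, e) => //=; apply: nbhs_singleton; apply: nbhs_interior.
  exact: nbhsx_ballx.
move=> /interior_subset/kspace_ball; rewrite kdist_kembed => yy'.
by exists y => //; apply: yA; rewrite ballEmdist.
Qed.

(** A uniform limit of distance functions takes arbitrarily small values, so it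
    vanishes at some point [y], and the inequalities force it to be the distance
    to [y]. *)
Lemma kembed_closed (R : realType) (Y : metricType R) :
  closed (range (@kembed R Y)).
Proof.
move=> F /= clF; have [_ [[y Fy]|[e e0 Fe]]] := kfunP F.
  exists y => //; apply: kspace_eq => w /=.
  by rewrite (katetov_zero (kfunP F) Fy).
have [_ [[y _ <-]]] := clF _ (nbhsx_ballx F e e0).
move=> /kspace_ball Fy; have := kdist_ub F (kembed y) y.
rewrite /= mdistxx subr0 => h; have := Fe y.
have := ler_norm (F y); lra.
Qed.

(** The retraction given by the definition, expressed on plain functions so that
    convex combinations can be formed without proofs of membership. *)
Lemma anr_katetov_retract (R : realType) (Y : metricType R) (y0 : Y) :
  absolute_neighborhood_retract Y ->
  exists (U : set (Y -> R)) (r : (Y -> R) -> Y),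
    [/\ forall y, r (mdist y) = y,
        forall y, exists2 d, 0 < d & forall F, katetov F ->
          (forall w, `|F w - mdist y w| <= d) -> U F,
        U `<=` @katetov R Y &
        forall F, U F -> forall e, 0 < e -> exists2 d, 0 < d &
          forall G, U G -> (forall w, `|F w - G w| <= d) ->
          mdist (r F) (r G) < e].
Proof.
move=> /(_ (kspace Y) _ (@kembed_embedding R Y) (@kembed_closed R Y)).
move=> [U [r0 [rU cr rUi rid]]].
have [k kE] : {k : (Y -> R) -> kspace Y | forall F, katetov F -> k F = F :> (Y -> R)}.
  exists (fun F => if pselect (katetov F) is left h then KSpace h else kembed y0).
  by move=> F hF; case: pselect.
have kK (F : kspace Y) : k F = F by apply: kspace_eq => w; rewrite kE//; exact: kfunP.
have [s sE] : {s : kspace Y -> Y | forall F, range (@kembed R Y) F -> kembed (s F) = F}.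
  exists (fun F => xget y0 [set y | kembed y = F]).
  by move=> F [y _ yF]; have := @xgetPex _ y0 [set y | kembed y = F] (ex_intro _ y yF).
exists [set F | katetov F /\ U (k F)], (fun F => s (r0 (k F))); split.
- move=> y; have <- : kembed y = k (mdist y).
    by apply: kspace_eq => w; rewrite kE //; exact: katetov_mdist.
  rewrite rid; last by exists y.
  by have [+ _ _] := kembed_embedding Y; apply; apply: sE; exists y.
- move=> y; have : nbhs (kembed y) U by apply: rU; exists y.
  move=> /nbhs_ballP[d d0 dU]; exists (d / 2); first by rewrite divr_gt0.
  move=> F kF Fy; split=> //; apply: dU; apply/kspace_ball.
  rewrite (@le_lt_trans _ _ (d / 2))//; last by have : 0 < d by []; lra.
  apply: kdist_le => [|w]; first by rewrite divr_ge0// ltW.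
  by rewrite kE// distrC.
- by move=> F [].
- move=> F [kF UF] e e0.
  move/cont_onP: cr => cr; have := cr _ UF _ (nbhsx_ballx (r0 (k F)) e e0).
  move=> /nbhs_ballP[d d0 dU]; exists (d / 2); first by rewrite divr_gt0.
  move=> G [kG UG] FG.
  have : ball (r0 (k F)) e (r0 (k G)).
    apply: dU => //; apply/kspace_ball.
    rewrite (@le_lt_trans _ _ (d / 2))//; last by have : 0 < d by []; lra.
    apply: kdist_le => [|w]; first by rewrite divr_ge0// ltW.
    by rewrite !kE.
  rewrite ballEmdist /= -(kdist_kembed (s _)) !sE //.
    by apply: rUi; exists (k G).
  by apply: rUi; exists (k F).
Qed.

(** * Convex combinations *)

(** The clause to check is the last one when both functions vanish, at two
    different points: there the triangle inequality bounds the combination from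
    below by a positive multiple of their distance. *)
Lemma katetov_conv (R : realType) (Y : metricType R) (F G : Y -> R) (t : R) :
  0 <= t <= 1 -> katetov F -> katetov G ->
  katetov (fun w => (1 - t) * F w + t * G w).
Proof.
move=> /andP[t0 t1] kF kG; split.
  move=> w w'; have [f1 f2] := kF.1 w w'; have [g1 g2] := kG.1 w w'.
  by split; nra.
have F0 w := katetov_ge0 w kF; have G0 w := katetov_ge0 w kG.
have [->|tn0] := eqVneq t 0.
  have [_ [[y Fy]|[e e0 Fe]]] := kF; [left; exists y|right; exists e => // w].
    by rewrite Fy; lra.
  by have := Fe w; lra.
have [->|tn1] := eqVneq t 1.
  have [_ [[y Fy]|[e e0 Fe]]] := kG; [left; exists y|right; exists e => // w].
    by rewrite Fy; lra.
  by have := Fe w; lra.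
have {}t0 : 0 < t by rewrite lt_neqAle eq_sym tn0.
have {}t1 : t < 1 by rewrite lt_neqAle tn1.
have [_ [[y Fy]|[e e0 Fe]]] := kF; last first.
  right; exists ((1 - t) * e) => [|w]; first by rewrite mulr_gt0// subr_gt0.
  by have := Fe w; have := G0 w; nra.
have [_ [[y' Gy]|[e e0 Ge]]] := kG; last first.
  right; exists (t * e) => [|w]; first by rewrite mulr_gt0.
  by have := Ge w; have := F0 w; nra.
have [yy'|yy'] := eqVneq y y'.
  by left; exists y; rewrite Fy yy' Gy; lra.
have d0 : 0 < mdist y y' by rewrite mdist_gt0.
rewrite (katetov_zero kF Fy) (katetov_zero kG Gy).
right; exists (Num.min t (1 - t) * mdist y y').
  by rewrite mulr_gt0// lt_min t0 subr_gt0.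
move=> w; have := metric_triangle y w y'; rewrite (metric_sym w y').
have := mdist_ge0 y w; have := mdist_ge0 y' w.
rewrite /Num.min; case: ifP => h h1 h2 h3; first by nra.
have : 1 - t <= t by rewrite leNgt h.
by nra.
Qed.

(** Each point of [s] is represented by its distance function; the division
    normalizes the weights. *)
Definition barycentre (R : realType) (Y : metricType R) (s : seq Y) (z : Y -> R)
    : Y -> R :=
  fun w => (\sum_(a <- s) z a * mdist a w) / \sum_(a <- s) z a.

Lemma katetov_barycentre (R : realType) (Y : metricType R) (s : seq Y)
    (z : Y -> R) :
  (forall a, 0 <= z a) -> 0 < \sum_(a <- s) z a ->
  katetov (barycentre s z).
Proof.
move=> z0; elim: s => [|a s IH]; first by rewrite big_nil ltxx.
have S0 : 0 <= \sum_(b <- s) z b by apply: sumr_ge0.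
rewrite big_cons => h; rewrite /barycentre.
have [sz|sn0] := eqVneq (\sum_(b <- s) z b) 0.
  rewrite (_ : (fun _ => _) = mdist a); first exact: katetov_mdist.
  apply/funext => w; rewrite !big_cons sz.
  rewrite big1_seq; last first.
    move=> b /= bs; move/eqP: sz; rewrite psumr_eq0// => /allP/(_ b bs) /=.
    by move/eqP->; rewrite mul0r.
  by rewrite sz !addr0 in h *; field; lra.
have sp : 0 < \sum_(b <- s) z b by rewrite lt_neqAle eq_sym sn0.
pose t := (\sum_(b <- s) z b) / (z a + \sum_(b <- s) z b).
have := @katetov_conv _ _ (mdist a) (barycentre s z) t _ (katetov_mdist a) (IH sp).
rewrite (_ : (fun w => (1 - t) * _ + _) =
  (fun w => (\sum_(b <- a :: s) z b * mdist b w) / (\sum_(b <- a :: s) z b))); last first.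
  apply/funext => w; rewrite !big_cons /t /barycentre.
  field; apply/andP; split; lra.
apply; rewrite /t divr_ge0 ?(ltW h)//= ler_pdivrMr// mul1r.
by rewrite lerDr.
Qed.

(** Continuity of a family of functions on [Y] for uniform convergence. *)
Definition supcont (R : realType) (S : topologicalType) (Y : Type) (A : set S)
    (F : S -> Y -> R) :=
  forall x, A x -> forall e, 0 < e ->
    \forall x' \near x, A x' -> forall w, `|F x w - F x' w| <= e.

Section supcont.
Context (R : realType) (S : topologicalType) (Y : metricType R) (A : set S).
Implicit Types F G : S -> Y -> R.

Lemma supcont_cst (B : Y -> R) : supcont A (fun=> B).
Proof.
by move=> x Ax e e0; apply: nearW => x' _ w; rewrite subrr normr0 ltW.
Qed.

Lemma supcont_D F G : supcont A F -> supcont A G ->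
  supcont A (fun x w => F x w + G x w).
Proof.
move=> cF cG x Ax e e0; have e20 : 0 < e / 2 by rewrite divr_gt0.
move: (cF x Ax _ e20) (cG x Ax _ e20); apply: filterS2 => x' h1 h2 Ax' w.
by move: (h1 Ax' w) (h2 Ax' w); rewrite !ler_norml => /andP[? ?] /andP[? ?];
  apply/andP; split; lra.
Qed.

Lemma cont_on_dist (c : S -> R) : cont_on A c -> forall x, A x -> forall e, 0 < e ->
  \forall x' \near x, A x' -> `|c x - c x'| < e.
Proof.
move=> cc x Ax e e0; have := cc x Ax _ (nbhsx_ballx (c x) e e0).
by apply: filterS => x' h Ax'; exact: h.
Qed.

Lemma supcont_M (c : S -> R) G : cont_on A c -> supcont A G ->
  (forall x, A x -> exists M, forall w, `|G x w| <= M) ->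
  supcont A (fun x w => c x * G x w).
Proof.
move=> cc cG bG x Ax e e0; have [M GM] := bG x Ax.
pose C := `|c x| + 1; pose M' := `|M| + 1.
have C0 : 0 < C by rewrite ltr_pwDr. have M0 : 0 < M' by rewrite ltr_pwDr.
have e1 : 0 < Num.min 1 (e / (2 * M')) by rewrite lt_min ltr01/= divr_gt0// mulr_gt0.
have e2 : 0 < e / (2 * C) by rewrite divr_gt0// mulr_gt0.
move: (cont_on_dist cc Ax e1) (cG x Ax _ e2).
apply: filterS2 => x' h1 h2 Ax' w; move: (h1 Ax') (h2 Ax' w).
rewrite lt_min => /andP[k1 k2] k3.
rewrite (_ : _ - _ = (c x - c x') * G x w + c x' * (G x w - G x' w)); last by ring.
rewrite (le_trans (ler_normD _ _))// !normrM.
have k4 : `|c x'| <= C.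
  by rewrite /C -lerBlDl; rewrite (le_trans (lerB_dist _ _))// distrC ltW.
have k5 : `|c x - c x'| * `|G x w| <= e / (2 * M') * M'.
  apply: ler_pM => //; first exact: ltW.
  apply: le_trans (GM w) _.
  by rewrite /M'; have := ler_norm M; lra.
have k6 : `|c x'| * `|G x w - G x' w| <= C * (e / (2 * C)) by rewrite ler_pM.
have := lerD k5 k6; rewrite (_ : e / (2 * M') * M' + _ = e)//.
by field; apply/andP; split; lra.
Qed.

Lemma supcont_sum (I : Type) (s : seq I) (F : I -> S -> Y -> R) :
  (forall i, supcont A (F i)) -> supcont A (fun x w => \sum_(i <- s) F i x w).
Proof.
move=> cF; elim: s => [|i s IH].
  under [X in supcont _ X]eq_fun do (under eq_fun do rewrite big_nil).
  exact: supcont_cst.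
under [X in supcont _ X]eq_fun do (under eq_fun do rewrite big_cons).
exact: supcont_D.
Qed.

Lemma supcont_mdist (g : S -> Y) : cont_on A g -> supcont A (fun x => mdist (g x)).
Proof.
move=> cg x Ax e e0; have := cg x Ax _ (nbhsx_ballx (g x) e e0).
apply: filterS => x' h Ax' w; have := h Ax'; rewrite ballEmdist /= => h'.
have := metric_triangle (g x) (g x') w; have := metric_triangle (g x') (g x) w.
by rewrite (metric_sym (g x') (g x)) ler_norml => ? ?; apply/andP; split; lra.
Qed.

Lemma katetov_bounded (F0 G0 : Y -> R) : katetov F0 -> katetov G0 ->
  exists M, forall w, `|G0 w - F0 w| <= M.
Proof.
move=> kF kG; have [[y _]|] := pselect ([set: Y] !=set0); last first.
  by move=> n; exists 0 => w; exfalso; apply: n; exists w.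
exists (F0 y + G0 y) => w.
have [f1 f2] := kF.1 w y; have [g1 g2] := kG.1 w y.
by rewrite ler_norml; apply/andP; split; lra.
Qed.

Lemma supcont_conv F G (t : S -> R) :
  (forall x, A x -> katetov (F x)) -> (forall x, A x -> katetov (G x)) ->
  supcont A F -> supcont A G -> cont_on A t ->
  supcont A (fun x w => (1 - t x) * F x w + t x * G x w).
Proof.
move=> kF kG cF cG ct.
have : supcont A (fun x w => F x w + t x * (G x w + (-1) * F x w)).
  apply: supcont_D => //; apply: supcont_M => //.
    apply: supcont_D => // x Ax e e0; have := cF x Ax e e0.
    apply: filterS => x' h Ax' w; have := h Ax' w.
    by rewrite -mulrBr normrM normrN1 mul1r.
  move=> x Ax; have [M h] := katetov_bounded (kF x Ax) (kG x Ax).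
  by exists M => w; rewrite mulN1r.
congr supcont; apply/funext => x; apply/funext => w; ring.
Qed.

End supcont.

(** After subtraction of the distance to one of the points, the functions that
    are averaged are bounded. *)
Lemma supcont_barycentre (R : realType) (S : topologicalType) (Y : metricType R)
    (A : set S) (s : seq Y) (c : S -> Y -> R) :
  (forall a, cont_on A (fun x => c x a)) ->
  (forall x, A x -> \sum_(a <- s) c x a != 0) ->
  supcont A (fun x => barycentre s (c x)).
Proof.
move=> cc c0; case: s c0 => [|a0 s'] c0.
  by move=> x Ax; have := c0 x Ax; rewrite big_nil eqxx.
move: (a0 :: s') c0 => s c0.
have : supcont A (fun x w => mdist a0 w +
    \sum_(a <- s) (c x a / \sum_(b <- s) c x b) * (mdist a w - mdist a0 w)).
  apply: supcont_D; first exact: supcont_cst.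
  apply: supcont_sum => a; apply: supcont_M; last 2 first.
  - exact: supcont_cst.
  - by move=> x Ax; apply: katetov_bounded; exact: katetov_mdist.
  apply/cont_on_cvg => x Ax; apply: cvgM.
    by have /cont_on_cvg := cc a; exact.
  apply: cvgV; first exact: c0.
  have /cont_on_cvg : cont_on A (fun x => \sum_(b <- s) c x b) by exact: cont_on_sum.
  exact.
move=> h x Ax e e0; have := h x Ax e e0; apply: filterS => x' h' Ax' w.
suff E y : A y -> barycentre s (c y) w = mdist a0 w +
    \sum_(a <- s) (c y a / \sum_(b <- s) c y b) * (mdist a w - mdist a0 w).
  by rewrite !E//; exact: h'.
move=> Ay; have n0 := c0 y Ay.
under eq_bigr do rewrite mulrBr.
rewrite sumrB -[X in _ + (_ - X)]mulr_suml -mulr_suml divff// mul1r.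
rewrite addrC subrK /barycentre mulr_suml; apply: eq_bigr => a _.
by rewrite mulrAC.
Qed.

(** * Paracompactness of metric spaces *)

Section SupFun.
Context (R : realType) (Y : metricType R) (I : Type) (P : set I)
  (phi : I -> Y -> R).
Hypothesis phi1 : forall i y, phi i y <= 1.
Hypothesis phiL : forall i y y', phi i y - phi i y' <= mdist y y'.

(** The value 0 is added for empty families. *)
Definition supfun (y : Y) : R := sup ([set 0] `|` [set phi i y | i in P]).

Lemma supfun_ge0 y : 0 <= supfun y.
Proof.
apply: ub_le_sup; last by left.
by exists 1 => _ [->|[i _ <-]]//; exact: ler01.
Qed.

Lemma supfun_ge i y : P i -> phi i y <= supfun y.
Proof.
move=> Pi; apply: ub_le_sup; last by right; exists i.
by exists 1 => _ [->|[j _ <-]]//; exact: ler01.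
Qed.

Lemma supfun_le y c : 0 <= c -> (forall i, P i -> phi i y <= c) -> supfun y <= c.
Proof.
move=> c0 h; apply: ge_sup; first by exists 0; left.
by move=> _ [->//|[i Pi <-]]; exact: h.
Qed.

Lemma supfun_gt y c : 0 <= c -> c < supfun y -> exists2 i, P i & c < phi i y.
Proof.
move=> c0 h; apply: contrapT => nex; move: h; rewrite ltNge => /negP; apply.
apply: supfun_le => // i Pi; rewrite leNgt; apply/negP => ci.
by apply: nex; exists i.
Qed.

Lemma supfun_lip y y' : supfun y - supfun y' <= mdist y y'.
Proof.
rewrite lerBlDr; apply: supfun_le => [|i Pi].
  by rewrite addr_ge0 ?mdist_ge0// supfun_ge0.
by have := supfun_ge y' Pi; have := phiL i y y'; lra.
Qed.

End SupFun.

Lemma lip_continuous (R : realType) (Y : metricType R) (h : Y -> R) :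
  (forall y y', h y - h y' <= mdist y y') -> continuous h.
Proof.
move=> hl y; apply/cvgrPdist_lt => e e0.
have : nbhs y (ball y e) by exact: nbhsx_ballx.
apply: filterS => y'; rewrite ballEmdist /= => yy'.
have := hl y y'; have := hl y' y; rewrite (metric_sym y' y) => h1 h2.
by rewrite ltr_norml; apply/andP; split; lra.
Qed.

Lemma seq_max (R : realType) (T : eqType) (f : T -> R) (s : seq T) (x0 : T) :
  x0 \in s -> exists2 a, a \in s & forall b, b \in s -> f b <= f a.
Proof.
elim: s x0 => // x s IH x0 _.
case: s IH => [_|y s IH].
  by exists x; rewrite ?inE// => b; rewrite inE => /eqP->.
have [a ain amax] := IH y (mem_head y s).
have [fxa|fxa] := leP (f x) (f a).
  exists a; first by rewrite inE ain orbT.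
  by move=> b; rewrite inE => /predU1P[->//|]; exact: amax.
exists x; first exact: mem_head.
move=> b; rewrite inE => /predU1P[->//|/amax h].
exact: le_trans h (ltW fxa).
Qed.

(** M. E. Rudin's construction.  The hypotheses on [sm] say that [sm y] is the
    first centre, for some well-ordering, of a ball that contains [y].  A piece
    of level [n] is a ball of radius [r n] around a point [x] that is not covered
    by the previous levels and whose ball of radius [3 * r n] lies in the ball of
    centre [sm x].  Near a given point, only finitely many levels occur, since
    later pieces avoid what is already covered; and at each level only one centre
    occurs, since pieces of the same level with different centres are at distance
    at least [r n]. *)
Section Rudin.
Context (R : realType) (Y : metricType R) (delta : Y -> R).

Let U a : set Y := [set y | mdist a y < delta a].
Let r (n : nat) : R := 2^-1 ^+ n.

Let r_gt0 n : 0 < r n. Proof. by rewrite exprn_gt0// invr_gt0. Qed.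

Let rS n : r n = 2 * r n.+1.
Proof. by rewrite /r exprS; field. Qed.

Let r_le m n : (m <= n)%N -> r n <= r m.
Proof.
by move=> mn; apply: ler_wiXn2l => //; lra.
Qed.

Let r_small e : 0 < e -> exists n, r n < e.
Proof.
move=> e0; have : (fun n => r n) @ \oo --> (0 : R).
  by apply: cvg_expr; rewrite ger0_norm; lra.
move=> /cvgrPdist_lt/(_ e e0)[n _ /(_ n (leqnn n))].
by rewrite sub0r normrN ger0_norm ?(ltW (r_gt0 n))//; exists n.
Qed.

Variables (sm : Y -> Y).
Hypothesis smU : forall y, U (sm y) y.
Hypothesis smP : forall y z, sm y <> sm z -> ~ U (sm y) z \/ ~ U (sm z) y.

Fixpoint rudin_cov (n : nat) : set Y :=
  if n is m.+1 then rudin_cov m `|` [set y | exists x,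
    [/\ ~ rudin_cov m x, (forall w, mdist x w < 3 * r m -> U (sm x) w) &
        mdist x y < r m]]
  else set0.

Let good n x := ~ rudin_cov n x /\ (forall w, mdist x w < 3 * r n -> U (sm x) w).

Let cov_mono m n : (m <= n)%N -> rudin_cov m `<=` rudin_cov n.
Proof.
move=> /subnK <-; elim: (n - m)%N => [//|k IH] y my.
by rewrite addSn; left; exact: IH.
Qed.

Let cov_ex n y : rudin_cov n y -> exists m x, [/\ good m x & mdist x y < r m].
Proof.
elim: n => [//|n IH] [/IH//|[x [h1 h2 h3]]].
by exists n, x.
Qed.

Let good_cov n x y : good n x -> mdist x y < r n -> rudin_cov n.+1 y.
Proof. by move=> [h1 h2] h; right; exists x. Qed.

Let cover y : exists n x, good n x /\ mdist x y < r n.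
Proof.
pose d := delta (sm y) - mdist (sm y) y.
have d0 : 0 < d by rewrite subr_gt0; exact: smU.
have [n nd] := @r_small (d / 3) ltac:(by rewrite divr_gt0).
have [/cov_ex [m [x [? ?]]]|ny] := pselect (rudin_cov n y); first by exists m, x.
exists n, y; split; last by rewrite mdistxx.
split=> // w yw; rewrite /U /=.
rewrite (le_lt_trans (metric_triangle _ y _))//.
by rewrite -ltrBrDl; rewrite -/d; move: yw nd; move: (r n) => rn; lra.
Qed.

Let sep i x x' : good i x -> good i x' -> sm x <> sm x' -> 3 * r i <= mdist x x'.
Proof.
move=> [_ g] [_ g'] ne; rewrite leNgt; apply/negP => h.
by case: (smP ne); apply; [exact: g|apply: g'; rewrite metric_sym].
Qed.

Let pc (p : nat * Y) (y : Y) := r p.1 - mdist p.2 y.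
(** Positive exactly on the union of the pieces with centre [a]. *)
Let bump a y := supfun [set p | good p.1 p.2 /\ sm p.2 = a] pc y.

Let pc1 p y : pc p y <= 1.
Proof.
rewrite /pc lerBlDr (le_trans (r_le (leq0n _)))// /r expr0 lerDl; exact: mdist_ge0.
Qed.

Let pcL p y y' : pc p y - pc p y' <= mdist y y'.
Proof.
rewrite /pc; have := metric_triangle p.2 y y'; lra.
Qed.

Let bump_gt0 a y : 0 < bump a y -> exists n x,
  [/\ good n x, sm x = a & mdist x y < r n].
Proof.
move=> /(supfun_gt (lexx 0))[[n x] [/= g s]]; rewrite /pc /= subr_gt0 => h.
by exists n, x.
Qed.

Let bump_pos a y n x : good n x -> sm x = a -> mdist x y < r n -> 0 < bump a y.
Proof.
move=> g s h; have := @supfun_ge _ _ _ [set p | good p.1 p.2 /\ sm p.2 = a] _ pc1 (n, x) y.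
by move=> /(_ (conj g s)); apply: lt_le_trans; rewrite /pc subr_gt0.
Qed.

Let bump_le1 a y : bump a y <= 1.
Proof. by apply: supfun_le => // i _; exact: pc1. Qed.

Let bumpL a y y' : bump a y - bump a y' <= mdist y y'.
Proof. exact: supfun_lip pc1 pcL _ _. Qed.

Let locfin (y : Y) : exists2 F : set Y, finite_set F &
  \forall z \near y, forall a, 0 < bump a z -> F a.
Proof.
have [N' [x0 [g0 xy0]]] := cover y.
(* the ball of radius [r j] around [y] lies in a piece of level [N'] *)
have [j rj] := @r_small (r N' - mdist x0 y) ltac:(by rewrite subr_gt0).
pose N := N'.+1.
have jN z : mdist y z < r j -> rudin_cov N z.
  move=> yz; apply: good_cov g0 _.
  by rewrite (le_lt_trans (metric_triangle _ y _))//; lra.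
pose j' := (maxn j N).+1.
pose F := [set a | exists i x z, [/\ (i < j')%N, good i x, sm x = a,
  mdist x z < r i & mdist y z < r j']].
exists F; last first.
  have : nbhs (y : Y) (ball y (r j')) by exact: nbhsx_ballx.
  apply: filterS => z; rewrite ballEmdist /= => yz a /bump_gt0[i [x [g s xz]]].
  have [ij|ij] := ltnP i j'; first by exists i, x, z.
  exfalso; have [+ _] := g; apply.
  have Ni : (N <= i)%N by rewrite (leq_trans _ ij)// /j' leqW// leq_maxr.
  apply: (cov_mono Ni); apply: jN.
  have := r_le ij; have : r (maxn j N) <= r j by apply: r_le; rewrite leq_maxl.
  rewrite (rS (maxn j N)) -/j'.
  have := metric_triangle y z x; rewrite (metric_sym z x).
  by move: xz yz; lra.
pose G i := [set a | exists x z, [/\ good i x, sm x = a,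
  mdist x z < r i & mdist y z < r j']].
have Guniq i a b : (i < j')%N -> G i a -> G i b -> a = b.
  move=> ij [x [z [g s xz yz]]] [x' [z' [g' s' xz' yz']]].
  apply: contrapT => ab.
  have := sep g g'; rewrite s s' => /(_ ab).
  have /r_le : (i <= maxn j N)%N by rewrite -ltnS.
  rewrite (rS (maxn j N)) -/j'.
  have := metric_triangle x z x'; have := metric_triangle z y x'.
  have := metric_triangle y z' x'; rewrite (metric_sym z' x') (metric_sym z y).
  by move: xz yz xz' yz'; lra.
apply: (@sub_finite_set _ _ ((fun i => xget y (G i)) @` `I_j')).
  move=> a [i [x [z [ij g s xz yz]]]]; exists i => //.
  have Ga : G i a by exists x, z.
  apply: (Guniq i) => //; exact: (xgetI y Ga).
exact/finite_image/finite_II.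
Qed.

(** The supremum is a maximum because the family is locally finite; dividing by
    it gives functions one of which is 1 at each point. *)
Let top y := supfun setT bump y.

Let topL y y' : top y - top y' <= mdist y y'.
Proof. exact: supfun_lip bump_le1 bumpL _ _. Qed.

Let top_ge a y : bump a y <= top y.
Proof. by apply: supfun_ge. Qed.

Let top_gt0 y : 0 < top y.
Proof.
have [n [x [g h]]] := cover y.
exact: lt_le_trans (bump_pos g erefl h) (top_ge _ _).
Qed.

Let bump_ge0 a y : 0 <= bump a y. Proof. by apply: supfun_ge0; exact: pc1. Qed.

Let top_att y : exists a, bump a y = top y.
Proof.
have [F finF /nbhs_singleton FP] := locfin y.
have [n [x [g h]]] := cover y.
have p0 := bump_pos g erefl h.
have [s sF] : exists s : seq Y, F = [set` s] by apply/finite_seqP.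
have xs : sm x \in s by have := FP _ p0; rewrite sF.
have [a _ amax] := seq_max (fun a => bump a y) xs.
exists a; apply/eqP; rewrite eq_le top_ge /=.
apply: supfun_le => // b _.
have [b0|b0] := leP (bump b y) 0; first by rewrite (le_trans b0).
by apply: amax; have := FP _ b0; rewrite sF.
Qed.

Lemma rudin_family : exists lam : Y -> Y -> R,
  [/\ forall a, continuous (lam a), forall a y, 0 <= lam a y <= 1,
      forall a y, 0 < lam a y -> mdist a y < delta a,
      forall y, exists a, lam a y = 1 &
      forall y : Y, exists2 F : set Y, finite_set F &
        \forall z \near y, forall a, 0 < lam a z -> F a].
Proof.
have pos a y : (0 < bump a y / top y) = (0 < bump a y) by rewrite pmulr_lgt0// invr_gt0.
exists (fun a y => bump a y / top y); split.
- move=> a y; apply: cvgM; first exact: lip_continuous.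
  apply: cvgV; first by rewrite gt_eqF.
  exact: (@lip_continuous _ _ top).
- move=> a y; rewrite divr_ge0//=; last exact: ltW.
  by rewrite ler_pdivrMr// mul1r.
- move=> a y; rewrite pos => /bump_gt0[n [x [[_ g] <- xy]]].
  by apply: g; rewrite (lt_trans xy)//; have := r_gt0 n; lra.
- by move=> y; have [a ay] := top_att y; exists a; rewrite ay divff// gt_eqF.
- move=> y; have [F finF FP] := locfin y; exists F => //.
  by move: FP; apply: filterS => z h a; rewrite pos; exact: h.
Qed.

End Rudin.

(** Every cover by balls has a locally finite refinement, given by functions.
    At each point one of them is 1, as the faces of the cubical nerve require. *)
Lemma metric_bumps (R : realType) (Y : metricType R) (delta : Y -> R) :
  (forall a, 0 < delta a) ->
  exists lam : Y -> Y -> R,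
  [/\ forall a, continuous (lam a), forall a y, 0 <= lam a y <= 1,
      forall a y, 0 < lam a y -> mdist a y < delta a,
      forall y, exists a, lam a y = 1 &
      forall y : Y, exists2 F : set Y, finite_set F &
        \forall z \near y, forall a, 0 < lam a z -> F a].
Proof.
move=> d0; have [le wo] := well_ordering_principle Y.
pose U y : pred Y := fun a => `[< mdist a y < delta a >].
have Uex y : nonempty (U y).
  by exists y; apply/asboolP; rewrite mdistxx.
have smE y : exists a, minimum_of le (U y) a.
  by have [a [ha _]] := wo (U y) (Uex y); exists a.
pose sm y := xget y (minimum_of le (U y)).
have smP y : minimum_of le (U y) (sm y) by exact: xgetPex (smE y).
apply: (@rudin_family _ _ _ sm) => [y|y z ne].
  by have [/asboolP] := smP y.
apply: contrapT => /not_orP[/contrapT h1 /contrapT h2]; apply: ne.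
have [yU yl] := smP y; have [zU zl] := smP z.
have pN : nonempty (pred2 (sm y) (sm z)) by exists (sm y); rewrite inE eqxx.
have refl x : le x x.
  have [a [[/eqP-> la] _]] : exists! a, minimum_of le (pred1 x) a.
    by apply: wo; exists x; rewrite inE.
  by apply: la; rewrite inE.
have l1 : le (sm y) (sm z) by apply: yl; apply/asboolP.
have l2 : le (sm z) (sm y) by apply: zl; apply/asboolP.
have [m [_ um]] := wo _ pN.
have e1 : m = sm y.
  apply: um; split; first by rewrite inE /= eqxx.
  by move=> x /pred2P[] ->.
have e2 : m = sm z.
  apply: um; split; first by rewrite inE /= eqxx orbT.
  by move=> x /pred2P[] ->.
by rewrite -e1 -e2.
Qed.

(** * Boxes *)

Section RowTopology.
Context (R : realType).

Lemma cont_on_coord (n : nat) (A : set 'rV[R]_n) (i : 'I_n) :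
  cont_on A (fun z : 'rV[R]_n => z ord0 i).
Proof. by apply: cont_onT => z; exact: coord_continuous. Qed.

Lemma cont_on_row (S : topologicalType) (A : set S) (n : nat)
    (F : 'I_n -> S -> R) :
  (forall i, cont_on A (F i)) -> cont_on A (fun x => \row_i F i x).
Proof.
move=> cF x Ax O [P PM PO].
have : \forall y \near x, forall i, [set: 'I_n] i -> A y -> P ord0 i (F i y).
  apply: near_finite_set => // i _; apply: cF => //.
  by have := PM ord0 i; rewrite mxE.
apply: filterS => y h Ay; apply: PO => k i.
by rewrite (ord1 k) mxE; exact: h.
Qed.

Lemma row_hausdorff (n : nat) : hausdorff_space 'rV[R]_n.
Proof.
move=> p q pq; apply/rowP => i; apply: (@Rhausdorff R) => A B Ap Bq.
have cA : nbhs p ((fun z : 'rV[R]_n => z ord0 i) @^-1` A).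
  by apply: (@coord_continuous _ _ _ ord0 i).
have cB : nbhs q ((fun z : 'rV[R]_n => z ord0 i) @^-1` B).
  by apply: (@coord_continuous _ _ _ ord0 i).
by have [z [Az Bz]] := pq _ _ cA cB; exists (z ord0 i).
Qed.

End RowTopology.

Section Box.
Context (R : realType) (n : nat).
Implicit Types (lo hi : 'I_n -> R) (z : 'rV[R]_n).

Definition box lo hi : set 'rV[R]_n :=
  [set z | forall i, lo i <= z ord0 i <= hi i].

(** Only the directions in which the box has positive width count, so that a
    face of a box is again a box, with its own relative boundary. *)
Definition box_bdry lo hi : set 'rV[R]_n :=
  box lo hi `&`
  [set z | exists i, lo i < hi i /\ (z ord0 i = lo i \/ z ord0 i = hi i)].

Lemma box_compact lo hi : compact (box lo hi).
Proof.
have := @rV_compact R n (fun i => `[lo i, hi i]%classic) (fun i => @segment_compact R _ _).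
congr compact; apply/seteqP; split => z /= h i; have := h i; by rewrite in_itv.
Qed.

Lemma box_closed lo hi : closed (box lo hi).
Proof. by apply: compact_closed; [exact: row_hausdorff|exact: box_compact]. Qed.

Lemma box_bdry_closed lo hi : closed (box_bdry lo hi).
Proof.
apply: closedI; first exact: box_closed.
rewrite [X in closed X](_ : _ = [set z : 'rV[R]_n | \prod_(i | lo i < hi i)
   ((z ord0 i - lo i) * (z ord0 i - hi i)) = 0]).
  apply: closed_eq_fun; last exact: cont_on_cst.
  apply: cont_on_bigprod => i.
  by apply: cont_on_mul; apply: cont_on_sub; try exact: cont_on_coord;
    exact: cont_on_cst.
apply/seteqP; split => z /=.
  move=> [i [lh h]]; apply/eqP/prodf_eq0; exists i => //.
  by case: h => ->; rewrite subrr ?mul0r ?mulr0.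
move/eqP/prodf_eq0 => [i lh]; rewrite mulf_eq0 !subr_eq0 => /orP[]/eqP h;
  exists i; split => //; [by left|by right].
Qed.

Section Gauge.
Variables (lo hi : 'I_n -> R).
Hypothesis lohi : forall i, lo i <= hi i.
Let c i : R := (lo i + hi i) / 2.
Let h i : R := (hi i - lo i) / 2.

(** The Minkowski gauge of the box with respect to its centre; a degenerate
    direction contributes [_ / 0 = 0]. *)
Definition gauge z : R := \big[Num.max/0]_(i < n) (`|z ord0 i - c i| / h i).

Definition rescale (s : R) z : 'rV[R]_n :=
  \row_i (c i + s * (z ord0 i - c i)).

Let h0 i : 0 <= h i.
Proof. by rewrite divr_ge0// subr_ge0. Qed.

Lemma gauge_ge0 z : 0 <= gauge z.
Proof. by rewrite /gauge; apply: bigmax_ge_id. Qed.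

Lemma cont_on_gauge A : cont_on A gauge.
Proof.
apply: cont_on_bigmax => i; apply: cont_on_mul; last exact: cont_on_cst.
apply: cont_on_abs; apply: cont_on_sub; first exact: cont_on_coord.
exact: cont_on_cst.
Qed.

Let box_abs z i : box lo hi z -> `|z ord0 i - c i| <= h i.
Proof.
move=> /(_ i) /andP[h1 h2]; rewrite ler_norml; apply/andP; split;
  rewrite /c /h; lra.
Qed.

Let abs_box z : (forall i, `|z ord0 i - c i| <= h i) -> box lo hi z.
Proof.
move=> H i; have := H i; rewrite ler_norml => /andP[h1 h2].
by apply/andP; split; move: h1 h2; rewrite /c /h; lra.
Qed.

Lemma gauge_le1 z : box lo hi z -> gauge z <= 1.
Proof.
move=> bz; apply: bigmax_le => // i _; have [h1|h1] := eqVneq (h i) 0.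
  by rewrite h1 invr0 mulr0.
by rewrite ler_pdivrMr ?mul1r ?box_abs// lt_neqAle eq_sym h1 h0.
Qed.

Lemma gauge_ub z i : `|z ord0 i - c i| / h i <= gauge z.
Proof. exact: le_bigmax. Qed.

Lemma gauge_bdry z : box_bdry lo hi z -> gauge z = 1.
Proof.
move=> [bz [i [lh zi]]]; apply/eqP; rewrite eq_le gauge_le1//=.
have hp : 0 < h i by rewrite divr_gt0// subr_gt0.
apply: le_trans (gauge_ub z i); rewrite ler_pdivlMr// mul1r.
case: zi => ->; last first.
  by rewrite (_ : hi i - c i = h i) ?ler_norm// /c /h; lra.
by rewrite distrC (_ : c i - lo i = h i) ?ler_norm// /c /h; lra.
Qed.

Let gauge_abs z i : box lo hi z -> `|z ord0 i - c i| <= gauge z * h i.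
Proof.
move=> bz; have [h1|h1] := eqVneq (h i) 0.
  by have := box_abs i bz; rewrite h1 mulr0.
by rewrite -ler_pdivrMr ?gauge_ub// lt_neqAle eq_sym h1 h0.
Qed.

Lemma rescale_box s z : box lo hi z -> 0 <= s -> s * gauge z <= 1 ->
  box lo hi (rescale s z).
Proof.
move=> bz s0 sz; apply: abs_box => i; rewrite mxE addrAC subrr add0r.
rewrite normrM ger0_norm//.
have := gauge_abs i bz; have := h0 i; have := normr_ge0 (z ord0 i - c i).
by nra.
Qed.

Lemma rescale_bdry s z : box lo hi z -> 0 <= s -> s * gauge z = 1 ->
  box_bdry lo hi (rescale s z).
Proof.
move=> bz s0 sz; split; first by apply: rescale_box => //; rewrite sz.
have g0 : 0 < gauge z.
  by rewrite lt_neqAle gauge_ge0 andbT; apply: contra_eq_neq sz => <-;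
    rewrite mulr0 eq_sym oner_neq0.
have [i gi] : exists i, gauge z = `|z ord0 i - c i| / h i.
  apply: contrapT => /forallNP ne; have : gauge z < gauge z; last by rewrite ltxx.
  rewrite {1}/gauge; apply: bigmax_lt => // i _.
  by rewrite lt_neqAle gauge_ub andbT; apply/eqP => e; exact: (ne i).
have hp : 0 < h i.
  rewrite lt_neqAle h0 andbT; apply: contraTneq g0 => e.
  by rewrite gi -e invr0 mulr0 ltxx.
exists i; split; first by move: hp; rewrite /h; lra.
rewrite !mxE; have e : s * `|z ord0 i - c i| = h i.
  by move: sz; rewrite gi mulrA => /(congr1 ( *%R^~ (h i))); rewrite mulfVK ?gt_eqF// mul1r.
have [p|p] := leP 0 (z ord0 i - c i).
  by right; rewrite ger0_norm// in e; rewrite e /c /h; lra.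
left; rewrite ltr0_norm// in e.
by rewrite mulrN in e; move: e; rewrite /c /h; lra.
Qed.

Lemma rescale1 z : rescale 1 z = z.
Proof. by apply/rowP => i; rewrite mxE mul1r addrC subrK. Qed.

Lemma cont_on_rescale (S : topologicalType) (A : set S) (s : S -> R)
    (q : S -> 'rV[R]_n) :
  cont_on A s -> cont_on A q -> cont_on A (fun x => rescale (s x) (q x)).
Proof.
move=> cs cq; apply: cont_on_row => i; apply: cont_on_add; first exact: cont_on_cst.
apply: cont_on_mul => //; apply: cont_on_sub; last exact: cont_on_cst.
apply: (@cont_on_comp _ _ _ A setT q (fun z : 'rV[R]_n => z ord0 i)) => //.
exact: cont_on_coord.
Qed.

End Gauge.
End Box.

(** * Close maps into a retract are homotopic *)

Definition local_relation (R : realType) (Y : metricType R) (E : Y -> Y -> Prop) :=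
  forall y, exists2 d, 0 < d &
    forall a b, mdist y a < d -> mdist y b < d -> E a b.

Lemma local_relationI (R : realType) (Y : metricType R) (E1 E2 : Y -> Y -> Prop) :
  local_relation E1 -> local_relation E2 ->
  local_relation (fun a b => E1 a b /\ E2 a b).
Proof.
move=> h1 h2 y; have [d1 d10 H1] := h1 y; have [d2 d20 H2] := h2 y.
exists (Num.min d1 d2) => [|a b]; first by rewrite lt_min d10.
by rewrite !lt_min => /andP[? ?] /andP[? ?]; split; [exact: H1|exact: H2].
Qed.

Lemma local_relation_refl (R : realType) (Y : metricType R) (E : Y -> Y -> Prop) y :
  local_relation E -> E y y.
Proof. by move=> /(_ y)[d d0]; apply; rewrite mdistxx. Qed.

Definition equiconnection (R : realType) (Y : metricType R)
    (E : Y -> Y -> Prop) (h : Y * Y * R -> Y) :=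
  [/\ local_relation E, forall a b, h (a, b, 0) = a, forall a b, h (a, b, 1) = b,
      forall a t, h (a, a, t) = a &
      cont_on [set p : Y * Y * R | E p.1.1 p.1.2 /\ 0 <= p.2 <= 1] h].

(** Points that are close in [Y] are joined by the segment between their
    distance functions, retracted to [Y]. *)
Lemma locally_equiconnected (R : realType) (Y : metricType R) (y0 : Y) :
  absolute_neighborhood_retract Y ->
  exists (E : Y -> Y -> Prop) (h : Y * Y * R -> Y), equiconnection E h.
Proof.
move=> /(anr_katetov_retract y0)[U [r [rid Unear Ukat rcont]]].
pose seg (p : Y * Y * R) w := (1 - p.2) * mdist p.1.1 w + p.2 * mdist p.1.2 w.
exists (fun a b => forall t, 0 <= t <= 1 -> U (seg (a, b, t))), (fun p => r (seg p)).
split.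
- move=> y; have [d d0 dU] := Unear y; exists d => // a b ya yb t t01.
  apply: dU; first by apply: katetov_conv => //; exact: katetov_mdist.
  move=> w; rewrite /seg /=; move/andP : t01 => [t0 t1].
  have := metric_triangle y a w; have := metric_triangle a y w.
  have := metric_triangle y b w; have := metric_triangle b y w.
  rewrite (metric_sym a y) (metric_sym b y) => k1 k2 k3 k4.
  by rewrite ler_norml; apply/andP; split; nra.
- move=> a b; rewrite -[RHS](rid a); congr r; apply/funext => w; rewrite /seg /=.
  by ring.
- move=> a b; rewrite -[RHS](rid b); congr r; apply/funext => w; rewrite /seg /=.
  by ring.
- move=> a t; rewrite -[RHS](rid a); congr r; apply/funext => w; rewrite /seg /=.
  by ring.
- apply: cont_on_metric => p pE e e0.
  have Up : U (seg p) by case: p pE => -[a b] t [/= h t01]; exact: h.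
  have [d d0 dr] := rcont _ Up e e0.
  set A := [set _ | _] in pE *.
  have : supcont A seg.
    apply: supcont_conv.
    - by move=> x _; exact: katetov_mdist.
    - by move=> x _; exact: katetov_mdist.
    - apply: supcont_mdist; apply: (@cont_on_comp _ _ _ _ setT); last exact: cont_on_fst.
        exact: cont_on_fst.
      by [].
    - apply: supcont_mdist; apply: (@cont_on_comp _ _ _ _ setT); last exact: cont_on_snd.
        exact: cont_on_fst.
      by [].
    - exact: cont_on_snd.
  move=> /(_ _ pE _ d0); apply: filterS => q h qA; apply: dr; last exact: h.
  by case: q qA {h} => -[a b] t [/= h t01]; exact: h.
Qed.

(** The contraction is run inwards along the rays of the box and is over when
    half of the way is done; the extension is then constant near the centre,
    where the rays meet. *)
Lemma contractible_cone (R : realType) (X : topologicalType) (A B : set X)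
    (n : nat) (lo hi : 'I_n -> R) (g : 'rV[R]_n -> X) :
  contractible_in R A B -> A !=set0 -> (forall i, lo i <= hi i) ->
  cont_on (box_bdry lo hi) g -> (forall z, box_bdry lo hi z -> A (g z)) ->
  exists G : 'rV[R]_n -> X, [/\ cont_on (box lo hi) G,
    forall z, box_bdry lo hi z -> G z = g z & forall z, box lo hi z -> B (G z)].
Proof.
rewrite /contractible_in unit_itvE.
move=> [xi [/cont_onP cxi xiB xi0 xi1]] [x0 Ax0] lohi cg gA.
pose m := gauge lo hi; pose k := xi (x0, 1).
pose G (z : 'rV[R]_n) := if m z <= 1 / 2 then k
  else xi (g (rescale lo hi (m z)^-1 z), 2 * (1 - m z)).
have big z : 1 / 2 <= m z -> (0 < m z) /\ (m z)^-1 * m z = 1.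
  move=> h; have p : 0 < m z by lra.
  by split => //; rewrite mulVf// gt_eqF.
have bd z : box lo hi z -> 1 / 2 <= m z -> box_bdry lo hi (rescale lo hi (m z)^-1 z).
  by move=> bz /big[m0 mm]; apply: rescale_bdry => //; rewrite invr_ge0 ltW.
have tm z : box lo hi z -> 1 / 2 <= m z -> 0 <= 2 * (1 - m z) <= 1.
  by move=> bz h; have := gauge_le1 lohi bz; rewrite -/(m z) => ?; apply/andP; split; lra.
have half z : m z = 1 / 2 -> 2 * (1 - m z) = 1 by move=> ->; lra.
have cm A' : cont_on A' m by exact: cont_on_gauge.
exists G; split.
- apply: (@cont_on_glue2 _ _ _ [set z | m z <= 1 / 2] [set z | 1 / 2 <= m z]).
  + by apply: closed_le_fun => //; exact: cont_on_cst.
  + by apply: closed_le_fun => //; exact: cont_on_cst.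
  + by move=> z _ /=; have [|/ltW] := leP (m z) (1 / 2); [left|right].
  + apply: (@cont_on_eq _ _ _ (fun=> k)); last exact: cont_on_cst.
    by move=> z [_ /= h]; rewrite /G h.
  + apply: (@cont_on_eq _ _ _ (fun z => xi (g (rescale lo hi (m z)^-1 z), 2 * (1 - m z)))).
      move=> z [bz /= h]; rewrite /G; case: ifP => // h'.
      have e : m z = 1 / 2 by apply/eqP; rewrite eq_le h'.
      rewrite half// /k; apply: xi1 => //; apply: gA; exact: bd.
    apply: (@cont_on_comp _ _ _ _ (A `*` @unit_itv R)
      (fun z => (g (rescale lo hi (m z)^-1 z), 2 * (1 - m z))) xi) => //.
      apply: cont_on_pair; last first.
        apply: cont_on_mul; first exact: cont_on_cst.
        by apply: cont_on_sub => //; exact: cont_on_cst.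
      apply: (@cont_on_comp _ _ _ _ (box_bdry lo hi)
        (fun z => rescale lo hi (m z)^-1 z) g) => //.
        apply: cont_on_rescale; last exact: cont_on_id.
        by apply: cont_on_inv => // z [_ /= /big[m0 _]]; rewrite gt_eqF.
      by move=> z [bz /= h]; exact: bd.
    move=> z [bz /= h]; split; first by apply: gA; exact: bd.
    exact: tm.
- move=> z zb; rewrite /G (_ : m z = 1); last exact: gauge_bdry.
  rewrite ifF; last by apply/negbTE; rewrite -ltNge; lra.
  by rewrite invr1 rescale1 subrr mulr0 xi0//; exact: gA.
- move=> z bz; apply: xiB; rewrite /G; case: ifPn => h.
    by exists (x0, 1) => //; split => //; rewrite /unit_itv/= ler01 lexx.
  rewrite -ltNge in h; exists (g (rescale lo hi (m z)^-1 z), 2 * (1 - m z)) => //.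
  split; first by apply: gA; apply: bd => //; exact: ltW.
  by apply: tm => //; exact: ltW.
Qed.

(** * Approximate lifting over a box *)

Section ApproxLift.
Context (R : realType) (X : topologicalType) (Y : metricType R) (f : X -> Y).
Hypothesis fcomp : compressive R f.

Section Fixed.
Context (n : nat) (phi : 'rV[R]_n -> Y).

(** [E] and [E'] measure how close the composites with [f] are to [phi]. *)
Definition lifts_upto (lo hi : 'I_n -> R) (E E' : Y -> Y -> Prop) :=
  forall g : 'rV[R]_n -> X, cont_on (box_bdry lo hi) g ->
    (forall z, box_bdry lo hi z -> E' (f (g z)) (phi z)) ->
    exists G : 'rV[R]_n -> X, [/\ cont_on (box lo hi) G,
      forall z, box_bdry lo hi z -> G z = g z &
      forall z, box lo hi z -> E (f (G z)) (phi z)].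

Definition approx_lift (lo hi : 'I_n -> R) (E : Y -> Y -> Prop) :=
  exists2 E', local_relation E' & lifts_upto lo hi E E'.

(** A box near [c] is filled by the contraction of the preimage of a
    neighborhood of [phi c]. *)
Lemma approx_lift_small (D : set 'rV[R]_n) (E : Y -> Y -> Prop) (c : 'rV[R]_n) :
  local_relation E -> cont_on D phi -> D c ->
  exists2 eta, 0 < eta & forall (z0 : 'rV[R]_n) e lo hi, ball c eta z0 -> e < eta ->
    (forall i, lo i <= hi i) -> box lo hi `<=` D -> box lo hi z0 ->
    (forall i, hi i - lo i < e) -> approx_lift lo hi E.
Proof.
move=> lE cphi Dc; have [d d0 dE] := lE (phi c).
have oV : open_nbhs (phi c) (ball (phi c) d)°.
  by split; [exact: open_interior|apply: nbhs_singleton; apply: nbhs_interior;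
    exact: nbhsx_ballx].
have [V' [oV' V'c] [_ _ V'V ctr]] := fcomp.2 _ _ oV.
have /nbhs_ballP[d' d'0 dV'] : nbhs (phi c) V' by exact: open_nbhs_nbhs.
pose e := Num.min d (d' / 2).
have e0 : 0 < e by rewrite lt_min d0 divr_gt0.
have : nbhs c [set z | D z -> mdist (phi c) (phi z) < e].
  have := cphi c Dc _ (nbhsx_ballx (phi c) e e0).
  by apply: filterS => z h Dz; have := h Dz; rewrite ballEmdist.
move=> /nbhs_ballP[eta /= eta0 etaP].
exists (eta / 2) => [|z0 e1 lo hi cz0 e1eta lohi bD bz0 small].
  by rewrite divr_gt0.
have bsmall z : box lo hi z -> mdist (phi c) (phi z) < e.
  move=> bz; apply: etaP; last exact: bD.
  rewrite [eta]splitr; apply: ball_triangle cz0 _.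
  split=> [|i j]; first by rewrite divr_gt0.
  rewrite (ord1 i) /ball/=; have := small j.
  have /andP[? ?] := bz j; have /andP[? ?] := bz0 j => sj.
  by rewrite ltr_norml; apply/andP; split; lra.
exists (fun a b => mdist a b < d' / 2).
  move=> y; exists (d' / 4) => [|a b ya yb]; first by rewrite divr_gt0.
  by have := metric_triangle a y b; rewrite (metric_sym a y); lra.
move=> g cg gphi.
have A0 : f @^-1` V' !=set0.
  by have [x _ xc] := fcomp.1 (phi c) I; exists x; rewrite /preimage/= xc.
have [G [cG Gg GB]] : exists G : 'rV[R]_n -> X, [/\ cont_on (box lo hi) G,
    forall z, box_bdry lo hi z -> G z = g z &
    forall z, box lo hi z -> (f @^-1` (ball (phi c) d)°) (G z)].
  apply: (contractible_cone ctr A0 lohi cg) => z bz; apply: dV'.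
  rewrite ballEmdist /=; have [b1 _] := bz.
  have := bsmall z b1; rewrite lt_min => /andP[_ h1]; have := gphi z bz.
  by have := metric_triangle (phi c) (phi z) (f (g z));
    rewrite (metric_sym (phi z)); lra.
exists G; split=> // z bz; apply: dE.
  by have /interior_subset := GB z bz; rewrite ballEmdist.
by have := bsmall z bz; rewrite lt_min => /andP[].
Qed.

Definition upd (lo : 'I_n -> R) (i : 'I_n) (c : R) : 'I_n -> R :=
  fun j => if j == i then c else lo j.

Lemma updE lo i c : upd lo i c i = c. Proof. by rewrite /upd eqxx. Qed.

Lemma upd_neq lo i c j : j != i -> upd lo i c j = lo j.
Proof. by rewrite /upd => /negbTE->. Qed.

(** The common face is lifted first, closely enough for the boundaries of both
    halves to be good for [E]; what this requires on the boundary of the face is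
    part of what is required on the boundary of the box. *)
Lemma approx_lift_split lo hi i c E :
  lo i < c < hi i -> local_relation E ->
  approx_lift lo (upd hi i c) E -> approx_lift (upd lo i c) hi E ->
  (forall E1, local_relation E1 -> approx_lift (upd lo i c) (upd hi i c) E1) ->
  approx_lift lo hi E.
Proof.
move=> /andP[loc chi] lE [E1 lE1 L1] [E2 lE2 L2] LF.
have [E3 lE3 L3] := LF _ (local_relationI lE1 lE2).
have boxE z : box lo hi z -> z ord0 i = c -> box (upd lo i c) (upd hi i c) z.
  move=> bz zi j; have [->|ji] := eqVneq j i; first by rewrite !updE zi lexx.
  by rewrite !upd_neq.
have box1 z : box lo (upd hi i c) z <-> box lo hi z /\ z ord0 i <= c.
  split=> [h|[h1 h2] j].
    split=> [j|]; last by have := h i; rewrite updE => /andP[].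
    have := h j; have [->|ji] := eqVneq j i; last by rewrite upd_neq.
    by rewrite updE => /andP[-> /= k]; exact: le_trans k (ltW chi).
  have [->|ji] := eqVneq j i; last by rewrite upd_neq.
  by have /andP[-> _] := h1 i; rewrite updE.
have box2 z : box (upd lo i c) hi z <-> box lo hi z /\ c <= z ord0 i.
  split=> [h|[h1 h2] j].
    split=> [j|]; last by have := h i; rewrite updE => /andP[].
    have := h j; have [->|ji] := eqVneq j i; last by rewrite upd_neq.
    by rewrite updE => /andP[k ->]; rewrite andbT; exact: le_trans (ltW loc) k.
  have [->|ji] := eqVneq j i; last by rewrite upd_neq.
  by have /andP[_ ->] := h1 i; rewrite updE h2.
have box3 z : box (upd lo i c) (upd hi i c) z <-> box lo hi z /\ z ord0 i = c.
  split=> [h|[h1 h2]]; last exact: boxE.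
  have zc : z ord0 i = c.
    by have := h i; rewrite !updE -eq_le => /eqP.
  split=> // j; have := h j; have [->|ji] := eqVneq j i; last by rewrite !upd_neq.
  by rewrite zc => _; rewrite !ltW.
have bd3 z : box_bdry lo hi z -> z ord0 i = c ->
    box_bdry (upd lo i c) (upd hi i c) z.
  move=> [bz [j [lj h]]] zi; split; first exact: boxE.
  have ji : j != i.
    apply/eqP => ji; subst j; rewrite zi in h.
    by case: h => e; move: loc chi; rewrite e ltxx.
  by exists j; rewrite !upd_neq.
have bd3' z : box_bdry (upd lo i c) (upd hi i c) z -> box_bdry lo hi z /\ z ord0 i = c.
  move=> [/box3[bz zi] [j]]; have [->|ji] := eqVneq j i.
    by rewrite !updE ltxx => -[].
  by rewrite !upd_neq// => h; split=> //; split=> //; exists j.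
have bd1 z : box_bdry lo (upd hi i c) z -> box_bdry lo hi z \/ z ord0 i = c.
  move=> [/box1[bz zi] [j]]; have [->|ji] := eqVneq j i.
    rewrite updE => -[_ [h|]]; last by right.
    by left; split=> //; exists i; rewrite (lt_trans loc chi); split=> //; left.
  by rewrite upd_neq// => h; left; split=> //; exists j.
have bd2 z : box_bdry (upd lo i c) hi z -> box_bdry lo hi z \/ z ord0 i = c.
  move=> [/box2[bz zi] [j]]; have [->|ji] := eqVneq j i.
    rewrite updE => -[_ [|h]]; first by right.
    by left; split=> //; exists i; rewrite (lt_trans loc chi); split=> //; right.
  by rewrite upd_neq// => h; left; split=> //; exists j.
exists (fun a b => E3 a b /\ (E1 a b /\ E2 a b)).
  by apply: local_relationI => //; exact: local_relationI.
move=> g cg gphi.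
have [GF [cGF GFg GFE]] : exists GF : 'rV[R]_n -> X,
    [/\ cont_on (box (upd lo i c) (upd hi i c)) GF,
      forall z, box_bdry (upd lo i c) (upd hi i c) z -> GF z = g z &
      forall z, box (upd lo i c) (upd hi i c) z ->
        E1 (f (GF z)) (phi z) /\ E2 (f (GF z)) (phi z)].
  apply: L3.
    by apply: cont_onS cg => z /bd3'[].
  by move=> z /bd3'[/gphi[]].
pose b (z : 'rV[R]_n) := if z ord0 i == c then GF z else g z.
have bg z : box_bdry lo hi z -> b z = g z.
  by move=> bz; rewrite /b; case: eqP => // zi; apply: GFg; exact: bd3.
have bGF (z : 'rV[R]_n) : z ord0 i = c -> b z = GF z by move=> zi; rewrite /b zi eqxx.
have cfac : closed [set z : 'rV[R]_n | z ord0 i = c].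
  by apply: closed_eq_fun; [exact: cont_on_coord|exact: cont_on_cst].
have cb (D : set 'rV[R]_n) : D `<=` box lo hi ->
    (forall z, D z -> box_bdry lo hi z \/ z ord0 i = c) -> cont_on D b.
  move=> Db h; apply: (@cont_on_glue2 _ _ _ (box_bdry lo hi) [set z : 'rV[R]_n | z ord0 i = c]) => //.
  - exact: box_bdry_closed.
  - apply: (@cont_on_eq _ _ _ g); first by move=> z [_ zb]; rewrite bg.
    by apply: cont_onS cg => z [].
  - apply: (@cont_on_eq _ _ _ GF); first by move=> z [_ zb]; rewrite bGF.
    by apply: cont_onS cGF => z [/Db bz zi]; exact: boxE.
have bE z : box lo hi z -> box_bdry lo hi z \/ z ord0 i = c ->
    E1 (f (b z)) (phi z) /\ E2 (f (b z)) (phi z).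
  move=> bz [zb|zi]; first by rewrite bg//; have [_] := gphi z zb.
  by rewrite bGF//; apply: GFE; exact: boxE.
have [G1 [cG1 G1b G1E]] : exists G : 'rV[R]_n -> X,
    [/\ cont_on (box lo (upd hi i c)) G,
      forall z, box_bdry lo (upd hi i c) z -> G z = b z &
      forall z, box lo (upd hi i c) z -> E (f (G z)) (phi z)].
  apply: L1; first by apply: cb => z; [move=> [/box1[]]|exact: bd1].
  by move=> z zb; have /box1[bz _] := zb.1; exact: (bE z bz (bd1 z zb)).1.
have [G2 [cG2 G2b G2E]] : exists G : 'rV[R]_n -> X,
    [/\ cont_on (box (upd lo i c) hi) G,
      forall z, box_bdry (upd lo i c) hi z -> G z = b z &
      forall z, box (upd lo i c) hi z -> E (f (G z)) (phi z)].
  apply: L2; first by apply: cb => z; [move=> [/box2[]]|exact: bd2].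
  by move=> z zb; have /box2[bz _] := zb.1; exact: (bE z bz (bd2 z zb)).2.
have f1 z : box lo hi z -> z ord0 i = c -> box_bdry lo (upd hi i c) z.
  move=> bz zi; split; first by apply/box1; rewrite zi.
  by exists i; rewrite updE; split=> //; right.
have f2 z : box lo hi z -> z ord0 i = c -> box_bdry (upd lo i c) hi z.
  move=> bz zi; split; first by apply/box2; rewrite zi.
  by exists i; rewrite updE; split=> //; left.
pose G (z : 'rV[R]_n) := if z ord0 i <= c then G1 z else G2 z.
have GG2 z : box lo hi z -> c <= z ord0 i -> G z = G2 z.
  move=> bz zc; rewrite /G; case: ifP => // zc'.
  have zi : z ord0 i = c by apply/eqP; rewrite eq_le zc'.
  by rewrite G1b ?G2b//; [exact: f2|exact: f1].
have GG1 (z : 'rV[R]_n) : z ord0 i <= c -> G z = G1 z by move=> h; rewrite /G h.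
exists G; split.
- apply: (@cont_on_glue2 _ _ _ [set z : 'rV[R]_n | z ord0 i <= c] [set z : 'rV[R]_n | c <= z ord0 i]).
  + by apply: closed_le_fun; [exact: cont_on_coord|exact: cont_on_cst].
  + by apply: closed_le_fun; [exact: cont_on_cst|exact: cont_on_coord].
  + by move=> z _ /=; have [|/ltW] := leP (z ord0 i) c; [left|right].
  + apply: (@cont_on_eq _ _ _ G1); first by move=> z [_ h]; rewrite GG1.
    by apply: cont_onS cG1 => z [? ?]; apply/box1.
  + apply: (@cont_on_eq _ _ _ G2); first by move=> z [? h]; rewrite GG2.
    by apply: cont_onS cG2 => z [? ?]; apply/box2.
- move=> z zb; have [bz [j [lj h]]] := zb.
  have [zc|/ltW zc] := leP (z ord0 i) c.
    rewrite GG1// G1b ?bg//; have [zi|zi] := eqVneq (z ord0 i) c; first exact: f1.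
    split; first exact/box1.
    have [ji|ji] := eqVneq j i; last by exists j; rewrite upd_neq.
    subst j; exists i; rewrite updE; split=> //; left.
    by case: h => // h; move: chi; rewrite ltNge -h zc.
  rewrite GG2// G2b ?bg//; have [zi|zi] := eqVneq (z ord0 i) c; first exact: f2.
  split; first exact/box2.
  have [ji|ji] := eqVneq j i; last by exists j; rewrite upd_neq.
  subst j; exists i; rewrite updE; split=> //; right.
  by case: h => // h; move: loc; rewrite ltNge -h zc.
- move=> z bz; have [zc|/ltW zc] := leP (z ord0 i) c.
    by rewrite GG1//; apply: G1E; apply/box1.
  by rewrite GG2//; apply: G2E; apply/box2.
Qed.

(** The dimension of a box. *)
Definition ndeg (lo hi : 'I_n -> R) := #|[pred i | lo i < hi i]|.

(** Induction on the dimension, for the faces between the pieces, and then on the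
    number of pieces; compactness gives a size [e] below which boxes are small in
    the sense of [approx_lift_small]. *)
Lemma approx_liftP lo hi E : (forall i, lo i <= hi i) ->
  cont_on (box lo hi) phi -> local_relation E -> approx_lift lo hi E.
Proof.
have [d] := ubnP (ndeg lo hi); elim: d => // d IHd in lo hi E *.
rewrite ltnS => nd lohi cphi lE.
have /compact_near_coveringP cov := @box_compact _ _ lo hi.
have : \forall e \near 0^'+, box lo hi `<=` (fun z0 => forall lo' hi',
    (forall i, lo' i <= hi' i) -> box lo' hi' `<=` box lo hi -> box lo' hi' z0 ->
    (forall i, hi' i - lo' i < e) -> approx_lift lo' hi' E).
  apply: cov => z0 bz0.
  have [eta eta0 etaP] := approx_lift_small lE cphi bz0.
  exists (ball z0 eta, [set e | e < eta]); last first.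
    by move=> [z e] [/= bz ee] lo' hi' h1 h2 h3 h4; exact: (etaP z e).
  by split; [exact: nbhsx_ballx|exact: nbhs_right_lt].
move=> near0.
have [e e0 eP] : exists2 e, 0 < e & forall lo' hi',
    (forall i, lo i <= lo' i <= hi' i /\ hi' i <= hi i) ->
    (forall i, hi' i - lo' i <= e) -> approx_lift lo' hi' E.
  have : \forall e \near (0:R)^'+, 0 < e by exact: nbhs_right_gt.
  move=> /filterI /(_ near0) /filter_ex[e [/= e0 eP]].
  exists (e / 2) => [|lo' hi' sub small]; first by rewrite divr_gt0.
  have sb : box lo' hi' `<=` box lo hi.
    move=> z bz i; have [/andP[? ?] ?] := sub i; have /andP[? ?] := bz i.
    by apply/andP; split; lra.
  have lohi' i : lo' i <= hi' i by have [/andP[]] := sub i.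
  pose z0 : 'rV[R]_n := \row_i lo' i.
  have bz0 : box lo' hi' z0 by move=> i; rewrite mxE lexx lohi'.
  apply: (eP z0) => // [|i]; first exact: sb.
  by have := small i; lra.
(* [k i] bounds the number of pieces of width [e] needed in direction [i] *)
suff H m (k : 'I_n -> nat) lo' hi' : (\sum_i k i <= m)%N ->
    (forall i, lo i <= lo' i <= hi' i /\ hi' i <= hi i) ->
    (forall i, hi' i - lo' i <= e * (k i)%:R) -> approx_lift lo' hi' E.
  pose k i := Num.bound ((hi i - lo i) / e).
  apply: (H _ k lo hi (leqnn _)) => i; first by rewrite !lexx lohi.
  rewrite mulrC -ler_pdivrMr//; apply: ltW; apply: archi_boundP.
  by rewrite divr_ge0 ?subr_ge0// ltW.
elim: m k lo' hi' => [|m IHm] k lo' hi' km sub small.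
  apply: eP => // i; apply: le_trans (small i) _.
  move: km; rewrite leqn0 sum_nat_eq0 => /forallP/(_ i)/= /eqP ->.
  by rewrite mulr0 ltW.
have [h|/existsNP[i /negP]] := pselect (forall i, hi' i - lo' i <= e); first exact: eP.
rewrite -ltNge => ei.
have [/andP[? lhi] ?] := sub i.
have k2 : (1 < k i)%N.
  rewrite ltnNge; apply/negP => k1; have := small i.
  have : (k i)%:R <= 1 :> R by rewrite -[1]/(1%:R) ler_nat.
  by nra.
have ksum : (\sum_(j | j != i) k j + k i <= m.+1)%N.
  by move: km; rewrite (bigD1 i)//= addnC.
pose c := lo' i + e.
have loc : lo' i < c < hi' i by rewrite /c; apply/andP; split; lra.
have /andP[loc1 loc2] := loc.
apply: (approx_lift_split loc lE).
- apply: (IHm (fun j => if j == i then 1%N else k j)).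
  + rewrite (bigD1 i)//= eqxx (eq_bigr k) => [|j /negbTE->//].
    by rewrite -ltnS; apply: leq_trans ksum; rewrite add1n -addn2 leq_add2l.
  + move=> j; have [->|ji] := eqVneq j i; rewrite ?updE ?upd_neq//.
    by split; first (apply/andP; split); lra.
  + move=> j; have [->|ji] := eqVneq j i; rewrite ?updE ?upd_neq//.
    by rewrite /c mulr1; lra.
- apply: (IHm (fun j => if j == i then (k i).-1 else k j)).
  + rewrite (bigD1 i)//= eqxx (eq_bigr k) => [|j /negbTE->//].
    by rewrite -ltnS; apply: leq_trans ksum; rewrite addnC -addnS prednK// ltnW.
  + move=> j; have [->|ji] := eqVneq j i; rewrite ?updE ?upd_neq//.
    by split; first (apply/andP; split); lra.
  + move=> j; have [->|ji] := eqVneq j i; rewrite ?updE ?upd_neq//.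
    have := small i; rewrite -(prednK (ltnW k2)) /= -natr1.
    by rewrite /c; lra.
- move=> E1 lE1; apply: IHd => //.
  + apply: leq_trans nd; rewrite /ndeg; apply: proper_card.
    apply/properP; split.
      apply/fintype.subsetP => j; rewrite !inE; have [->|ji] := eqVneq j i.
        by rewrite !updE ltxx.
      rewrite !upd_neq// => h; have [/andP[? ?] ?] := sub j; lra.
    exists i; first by rewrite inE; lra.
    by rewrite inE !updE ltxx.
  + move=> j; have [->|ji] := eqVneq j i; rewrite ?updE ?upd_neq//.
    by have [/andP[]] := sub j.
  + apply: cont_onS cphi => z bz j; have := bz j; have [/andP[? ?] ?] := sub j.
    have [->|ji] := eqVneq j i; rewrite ?updE ?upd_neq// => /andP[? ?];
      by apply/andP; split; lra.
Qed.

End Fixed.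
End ApproxLift.

(** * Lifting over a cube *)

Definition cube (R : realType) (n : nat) : set 'rV[R]_n :=
  box (fun=> 0) (fun=> 1).
Definition cube_bdry (R : realType) (n : nat) : set 'rV[R]_n :=
  box_bdry (fun=> 0) (fun=> 1).
Definition open_cube (R : realType) (n : nat) : set 'rV[R]_n :=
  @cube R n `\` @cube_bdry R n.
Arguments cube {R n}.
Arguments cube_bdry {R n}.
Arguments open_cube {R n}.

Lemma cube_innerP (R : realType) n (z : 'rV[R]_n) :
  open_cube z <-> forall i, 0 < z ord0 i < 1.
Proof.
split=> [[cz nb] i|h]; last first.
  split=> [i|[_ [i [_ e]]]]; first by have /andP[? ?] := h i; rewrite !ltW.
  by have := h i; case: e => ->; rewrite ltxx ?andbF.
have /andP[z0 z1] := cz i; rewrite !lt_neqAle z0 z1 !andbT.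
apply/andP; split; apply/eqP => e; apply: nb; split=> //; exists i; split => //.
  by left.
by right.
Qed.

Section CubeExtension.
Context (R : realType) (X : topologicalType) (Y : metricType R) (f : X -> Y).
Hypothesis fcont : continuous f.
Hypothesis fcomp : compressive R f.
Context (E : Y -> Y -> Prop) (h : Y * Y * R -> Y).
Hypothesis Eh : equiconnection E h.

Let lo01 n (i : 'I_n) : (0 : R) <= 1. Proof. exact: ler01. Qed.

(** The homotopy extension property of the cube and its boundary.  The product
    of the cube and the interval is retracted onto its sides and its lid, by
    projection from a point below the bottom, up to reparametrization: points
    whose multiple by [2 - t] stays in the cube go to the lid, the others to the
    sides. *)
Lemma collar_extension (n : nat) (phi : 'rV[R]_n -> Y) (th : 'rV[R]_n * R -> Y) :
  cont_on cube phi -> cont_on (cube_bdry `*` @unit_itv R) th ->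
  (forall z, cube_bdry z -> th (z, 1) = phi z) ->
  exists Psi : 'rV[R]_n * R -> Y,
    [/\ cont_on (cube `*` @unit_itv R) Psi,
      forall z, cube z -> Psi (z, 1) = phi z &
      forall z t, cube_bdry z -> 0 <= t <= 1 -> Psi (z, t) = th (z, t)].
Proof.
move=> cphi cth th1.
pose m : 'rV[R]_n -> R := gauge (fun=> 0) (fun=> 1).
pose rs := @rescale R n (fun=> 0) (fun=> 1).
have cm A : cont_on A (fun p : 'rV[R]_n * R => m p.1).
  apply: (@cont_on_comp _ _ _ _ setT fst m) => //; first exact: cont_on_fst.
  exact: cont_on_gauge.
have m0 z : 0 <= m z by exact: gauge_ge0.
have m1 z : cube z -> m z <= 1 by move=> cz; exact: (gauge_le1 (@lo01 n)).
pose w (p : 'rV[R]_n * R) := (2 - p.2) * m p.1.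
have cw A : cont_on A w.
  by apply: cont_on_mul => //; apply: cont_on_sub; [exact: cont_on_cst|exact: cont_on_snd].
pose Psi p := if w p <= 1 then phi (rs (2 - p.2) p.1)
  else th (rs (m p.1)^-1 p.1, 2 - w p).
have mp (p : 'rV[R]_n * R) : unit_itv p.2 -> 1 <= w p -> 0 < m p.1.
  move=> /andP[t0 t1] wp; rewrite lt_neqAle m0 andbT eq_sym.
  by apply: contraTneq wp => mz; rewrite /w mz mulr0 -ltNge ltr01.
have rin (p : 'rV[R]_n * R) : (cube `*` @unit_itv R) p -> w p <= 1 ->
    cube (rs (2 - p.2) p.1).
  move=> [cz /andP[t0 t1]] wp; apply: (rescale_box (@lo01 n)) => //; lra.
have rout (p : 'rV[R]_n * R) : (cube `*` @unit_itv R) p -> 1 <= w p ->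
    cube_bdry (rs (m p.1)^-1 p.1) /\ unit_itv (2 - w p).
  move=> [cz t01] wp; have mz := mp p t01 wp; split.
    apply: (rescale_bdry (@lo01 n)) => //; first by rewrite invr_ge0 ltW.
    by rewrite mulVf// gt_eqF.
  have /andP[t0 t1] := t01; have := m1 _ cz; rewrite /unit_itv/= => mz1.
  by apply/andP; split; last lra; rewrite /w; nra.
exists Psi; split.
- apply: (@cont_on_glue2 _ _ _ [set p | w p <= 1] [set p | 1 <= w p]).
  + by apply: closed_le_fun => //; exact: cont_on_cst.
  + by apply: closed_le_fun => //; exact: cont_on_cst.
  + by move=> p _ /=; have [|/ltW] := leP (w p) 1; [left|right].
  + apply: (@cont_on_eq _ _ _ (fun p : 'rV[R]_n * R => phi (rs (2 - p.2) p.1))).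
      by move=> p [_ /= k]; rewrite /Psi k.
    apply: (@cont_on_comp _ _ _ _ cube (fun p : 'rV[R]_n * R => rs (2 - p.2) p.1) phi) => //.
      apply: cont_on_rescale; last exact: cont_on_fst.
      by apply: cont_on_sub; [exact: cont_on_cst|exact: cont_on_snd].
    by move=> p [cp /= k]; exact: rin.
  + apply: (@cont_on_eq _ _ _ (fun p : 'rV[R]_n * R => th (rs (m p.1)^-1 p.1, 2 - w p))).
      move=> p [cp /= k]; rewrite /Psi; case: ifP => // k'.
      have e : w p = 1 by apply/eqP; rewrite eq_le k'.
      rewrite e (_ : 2 - 1 = 1); last by lra.
      have [? _] := rout p cp k; rewrite th1//.
      suff -> : (m p.1)^-1 = 2 - p.2 by [].
      have mz := mp p cp.2 k.
      have mn : m p.1 != 0 by rewrite gt_eqF.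
      by apply: (mulIf mn); rewrite mulVf.
    apply: (@cont_on_comp _ _ _ _ (cube_bdry `*` @unit_itv R)
      (fun p : 'rV[R]_n * R => (rs (m p.1)^-1 p.1, 2 - w p)) th) => //.
      apply: cont_on_pair; last by apply: cont_on_sub => //; exact: cont_on_cst.
      apply: cont_on_rescale; last exact: cont_on_fst.
      apply: cont_on_inv => // p [[_ t01] /= k].
      by rewrite gt_eqF//; exact: mp.
    by move=> p [cp /= k]; have [? ?] := rout p cp k.
- move=> z cz; rewrite /Psi /w /= (_ : 2 - 1 = 1); last by lra.
  by rewrite mul1r m1// /rs rescale1.
- move=> z t zb /andP[t0 t1]; have mz : m z = 1 by apply: (gauge_bdry (@lo01 n)).
  rewrite /Psi /w /= mz mulr1; case: ifPn => k.
    have -> : t = 1 by lra.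
    by rewrite (_ : 2 - 1 = 1) /rs ?rescale1 ?th1//; lra.
  by rewrite invr1 /rs rescale1; congr (th (_, _)); lra.
Qed.

(** [phi] is first moved, by the collar, to a map that agrees with [f \o g] on the
    boundary; this map is lifted approximately, and the two homotopies are
    concatenated.  The concatenation restricts to the given homotopy on the
    boundary because that one is stationary up to time [tau].  The result is
    stationary up to [tau / 2] only, which leaves time for the cells of the next
    dimension. *)
Lemma cube_extension (n : nat) (phi : 'rV[R]_n -> Y) (g : 'rV[R]_n -> X)
    (th : 'rV[R]_n * R -> Y) (tau : R) :
  cont_on cube phi -> cont_on cube_bdry g ->
  cont_on (cube_bdry `*` @unit_itv R) th -> 0 < tau < 1 ->
  (forall z t, cube_bdry z -> 0 <= t <= tau -> th (z, t) = f (g z)) ->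
  (forall z, cube_bdry z -> th (z, 1) = phi z) ->
  exists (G : 'rV[R]_n -> X) (Th : 'rV[R]_n * R -> Y),
    [/\ cont_on cube G, forall z, cube_bdry z -> G z = g z,
      cont_on (cube `*` @unit_itv R) Th,
      forall z t, cube z -> 0 <= t <= tau / 2 -> Th (z, t) = f (G z) &
      (forall z, cube z -> Th (z, 1) = phi z) /\
      (forall z t, cube_bdry z -> 0 <= t <= 1 -> Th (z, t) = th (z, t))].
Proof.
move=> cphi cg cth /andP[tau0 tau1] th0 th1; have [lE h0 h1 hh ch] := Eh.
have [Psi [cPsi Psi1 Psib]] := collar_extension cphi cth th1.
pose phi' z := Psi (z, tau).
have cphi' : cont_on cube phi'.
  apply: (@cont_on_comp _ _ _ _ (cube `*` @unit_itv R) (fun z : 'rV[R]_n => (z, tau)) Psi) => //.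
    by apply: cont_on_pair; [exact: cont_on_id|exact: cont_on_cst].
  by move=> z cz; split => //; rewrite /unit_itv/= !ltW.
have phib z : cube_bdry z -> phi' z = f (g z).
  by move=> zb; rewrite /phi' Psib ?th0// ?lexx !ltW.
have [E' lE' /(_ g cg)] := approx_liftP fcomp (@lo01 n) cphi' lE.
case=> [z zb|G [cG Gg GE]].
  by rewrite phib//; exact: local_relation_refl.
pose s (t : R) := Num.max 0 (2 * t / tau - 1).
have s01 t : t <= tau -> 0 <= s t <= 1.
  move=> tt; rewrite /s le_max lexx/= ge_max ler01/= lerBlDr ler_pdivrMr//.
  lra.
have s0 t : t <= tau / 2 -> s t = 0.
  move=> tt; apply/eqP; rewrite eq_le le_max lexx/= andbT ge_max lexx/= subr_le0.
  by rewrite ler_pdivrMr//; lra.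
have stau : s tau = 1.
  by rewrite /s -mulrA divff ?gt_eqF// mulr1 (_ : 2 - 1 = 1) ?max_r//; lra.
pose Th (p : 'rV[R]_n * R) := if p.2 <= tau then h (f (G p.1), phi' p.1, s p.2) else Psi p.
exists G, Th; split=> //.
- apply: (@cont_on_glue2 _ _ _ [set p : 'rV[R]_n * R | p.2 <= tau] [set p : 'rV[R]_n * R | tau <= p.2]).
  + by apply: closed_le_fun; [exact: cont_on_snd|exact: cont_on_cst].
  + by apply: closed_le_fun; [exact: cont_on_cst|exact: cont_on_snd].
  + by move=> p _ /=; have [|/ltW] := leP p.2 tau; [left|right].
  + apply: (@cont_on_eq _ _ _ (fun p : 'rV[R]_n * R => h (f (G p.1), phi' p.1, s p.2))).
      by move=> p [_ /= k]; rewrite /Th k.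
    apply: (@cont_on_comp _ _ _ _ [set p : Y * Y * R | E p.1.1 p.1.2 /\ 0 <= p.2 <= 1]
      (fun p : 'rV[R]_n * R => (f (G p.1), phi' p.1, s p.2)) h) => //.
      apply: cont_on_pair; [apply: cont_on_pair|].
      * apply: (@cont_on_comp _ _ _ _ setT (fun p : 'rV[R]_n * R => G p.1) f) => //.
          apply: (@cont_on_comp _ _ _ _ cube fst G) => //; first exact: cont_on_fst.
          by move=> p [[]].
        exact: cont_onT.
      * apply: (@cont_on_comp _ _ _ _ cube fst phi') => //; first exact: cont_on_fst.
        by move=> p [[]].
      * apply: cont_on_max; first exact: cont_on_cst.
        apply: cont_on_sub; last exact: cont_on_cst.
        apply: cont_on_mul; last exact: cont_on_cst.
        by apply: cont_on_mul; [exact: cont_on_cst|exact: cont_on_snd].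
    by move=> p [[cp _] /= k]; split; [exact: GE|exact: s01].
  + apply: (@cont_on_eq _ _ _ Psi); last by apply: cont_onS cPsi => p [].
    move=> [z t] [[cz _] /= k]; rewrite /Th /=; case: ifP => // k'.
    have -> : t = tau by apply/eqP; rewrite eq_le k'.
    by rewrite stau h1.
- move=> z t cz /andP[t0 tt]; rewrite /Th /= ifT; last by lra.
  by rewrite s0// h0.
- split=> [z cz|z t zb /andP[t0 t1]].
    by rewrite /Th /= ifF ?Psi1//; apply/negbTE; rewrite -ltNge.
  rewrite /Th /=; case: ifPn => k; last by rewrite Psib// t0.
  by rewrite Gg// phib// hh th0// t0.
Qed.

End CubeExtension.

(** * Lifting over a relative cell complex *)

(** The cells are given by their characteristic maps [q j], defined on cubes;
    the boundary of a cell lies in [A] and finitely many cells of smaller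
    dimension.  The lift is continuous on each cell; that it is continuous on a
    union of cells follows from the weak topology or from local finiteness in the
    applications. *)
Section CellExtension.
Context (R : realType) (X : topologicalType) (Y : metricType R) (f : X -> Y).
Hypothesis fcont : continuous f.
Hypothesis fcomp : compressive R f.
Context (E : Y -> Y -> Prop) (h : Y * Y * R -> Y).
Hypothesis Eh : equiconnection E h.

Context (T : topologicalType) (A : set T) (J : Type) (dim : J -> nat)
  (q : forall j, 'rV[R]_(dim j) -> T).
Hypotheses (hT : hausdorff_space T) (cA : closed A)
  (cq : forall j, cont_on cube (@q j))
  (qinj : forall p p' : {j : J & 'rV[R]_(dim j)},
    open_cube (projT2 p) -> open_cube (projT2 p') ->
    q (projT2 p) = q (projT2 p') -> p = p')
  (qA : forall j (z : 'rV[R]_(dim j)), open_cube z -> ~ A (q z))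
  (qfin : forall j, exists F : set J, [/\ finite_set F,
     forall k, F k -> (dim k < dim j)%N &
     forall z, cube_bdry z -> A (@q j z) \/ exists2 k, F k & (@q k @` cube) (q z)]).
Context (phi : T -> Y) (g0 : T -> X).
Hypotheses (cphi : forall j, cont_on cube (fun z => phi (@q j z)))
  (cg0 : cont_on A g0) (cphiA : cont_on A phi) (fg0 : forall x, A x -> f (g0 x) = phi x).

Let pt := {j : J & 'rV[R]_(dim j)}.
Let inner (p : pt) := open_cube (projT2 p).
Let qq (p : pt) : T := q (projT2 p).

Definition stage (n : nat) (x : T) :=
  A x \/ exists j z, [/\ (dim j < n)%N, cube z & @q j z = x].

Let tau (d : nat) : R := 2^-1 ^+ d.+2.

(** The times up to which the homotopies are stationary decrease with the
    dimension, as [cube_extension] requires. *)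
Definition partial_lift (n : nat) (GT : (T -> X) * (T * R -> Y)) :=
  (forall x, A x -> GT.1 x = g0 x /\ forall t, 0 <= t <= 1 -> GT.2 (x, t) = phi x) /\
  forall j, (dim j < n)%N ->
    [/\ cont_on cube (fun z => GT.1 (@q j z)),
      cont_on (cube `*` @unit_itv R) (fun p => GT.2 (@q j p.1, p.2)),
      forall z, cube z -> GT.2 (@q j z, 1) = phi (@q j z) &
      forall z t, cube z -> 0 <= t <= tau (dim j) ->
        GT.2 (@q j z, t) = f (GT.1 (@q j z))].

Let stage_open n x : stage n x ->
  A x \/ exists2 p : pt, inner p & (dim (projT1 p) < n)%N /\ qq p = x.
Proof.
move=> [Ax|[j [z [jn cz <-]]]]; first by left.
have [d] := ubnP (dim j); elim: d => // d IH in j z jn cz *.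
rewrite ltnS => jd.
have [zb|nzb] := pselect (cube_bdry z); last first.
  by right; exists (existT _ j z).
have [F [_ Fdim /(_ z zb)]] := qfin j; case=> [|[k /Fdim kj [z' cz' <-]]]; first by left.
apply: IH => //; first exact: ltn_trans jn.
exact: leq_trans jd.
Qed.

Let stage_disj n p : inner p -> dim (projT1 p) = n -> ~ stage n (qq p).
Proof.
move=> ip pn /stage_open[|[p' ip' [p'n e]]]; first exact: qA.
by move: p'n; rewrite (qinj ip' ip e) pn ltnn.
Qed.

Let qK j : compact (@q j @` cube).
Proof.
apply: continuous_compact; last exact: box_compact.
by apply/cont_onP; exact: cq.
Qed.

Let qC j : closed (@q j @` cube).
Proof. by apply: compact_closed => //; exact: qK. Qed.

Let itv_compact : compact (@unit_itv R).
Proof. by rewrite -unit_itvE; exact: segment_compact. Qed.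


Let hTR : hausdorff_space (T * R)%type.
Proof. by apply: hausdorff_prod => //; exact: Rhausdorff. Qed.

Let cbdry_comp n (G : T -> X) (Th : T * R -> Y) j : partial_lift n (G, Th) ->
  dim j = n -> cont_on cube_bdry (fun z => G (@q j z)) /\
  cont_on (cube_bdry `*` @unit_itv R) (fun p => Th (@q j p.1, p.2)).
Proof.
move=> [/= GA Gq] jn; have [F [finF Fdim qF]] := qfin j.
have Fn k : F k -> (dim k < n)%N by move=> /Fdim; rewrite jn.
pose B (o : option J) := if o is Some k then @q k @` cube else A.
have cB o : closed (B o) by case: o.
pose FB := [set None] `|` Some @` F.
have FBS k : FB (Some k) -> F k.
  by case=> [e|[k' Fk' e]]; [discriminate e|have [<-] := e].
have finFB : finite_set FB by rewrite finite_setU; split=> //; exact: finite_image.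
pose D := \bigcup_(o in FB) B o.
have qD z : cube_bdry z -> D (@q j z).
  move=> /qF[Az|[k Fk kz]]; first by exists None => //; left.
  by exists (Some k) => //; right; exists k.
split.
  apply: (@cont_on_comp _ _ _ _ D (@q j) G) => //.
    by apply: cont_onS (cq (j:=j)) => z [].
  apply: (@cont_on_glue _ _ _ D B) => x _; exists FB; split=> //.
    move=> [k|] oF; split=> //; last first.
      apply: (@cont_on_eq _ _ _ g0); first by move=> x' [_ /= /GA[]].
      by apply: cont_onS cg0 => x' [].
    have Fk : F k by exact: FBS.
    apply: (@cont_onS _ _ _ (@q k @` cube)); first by move=> x' [].
    by apply: cont_on_image; [|exact: box_compact|exact: cq|have [] := Gq k (Fn k Fk)].
  by apply: nearW => y [o FBo By]; exists o.
apply: (@cont_on_comp _ _ _ _ (D `*` @unit_itv R)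
    (fun p : 'rV[R]_(dim j) * R => (@q j p.1, p.2)) Th) => //.
- apply: cont_on_pair; last exact: cont_on_snd.
  apply: (@cont_on_comp _ _ _ _ cube fst (@q j)) => //; first exact: cont_on_fst.
  by move=> p [[]].
- by move=> p [zb t01]; split => //; exact: qD.
apply: (@cont_on_glue _ _ _ _ (fun o => B o `*` setT)) => x _; exists FB; split=> //.
  move=> o oF; split.
    rewrite (_ : _ `*` _ = fst @^-1` B o); last first.
      by apply/seteqP; split=> p //= -[].
    by apply: closed_comp => // p _; exact: cvg_fst.
  move: o oF => [k|] oF; last first.
    apply: (@cont_on_eq _ _ _ (fun p => phi p.1)).
      by move=> [x' t] [[_ t01] /= [/GA[_ ->]]].
    apply: (@cont_on_comp _ _ _ _ A fst phi) => //; first exact: cont_on_fst.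
    by move=> p [_ []].
  have Fk : F k by exact: FBS.
  pose qI (p : 'rV[R]_(dim k) * R) := (@q k p.1, p.2).
  apply: (@cont_onS _ _ _ (qI @` (cube `*` @unit_itv R))).
    by move=> [x' t] [[_ t01] /= [[z cz <-] _]]; exists (z, t).
  apply: cont_on_image => //.
  - by apply: compact_setX => //; exact: box_compact.
  - apply: cont_on_pair; last exact: cont_on_snd.
    apply: (@cont_on_comp _ _ _ _ cube fst (@q k)) => //; first exact: cont_on_fst.
    by move=> p [].
  - by have [] := Gq k (Fn k Fk).
by apply: (@filterE _ (nbhs x) (nbhs_filter x)) => y [[o FBo By] _]; exists o.
Qed.

Let tau_gt0 d : 0 < tau d. Proof. by rewrite exprn_gt0// invr_gt0. Qed.
Let tauS d : tau d.+1 = tau d / 2. Proof. by rewrite /tau exprSr. Qed.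
Let tau_lt1 d : tau d < 1.
Proof. by rewrite /tau exprn_ilt1//; lra. Qed.
Let tau_le d d' : (d <= d')%N -> tau d' <= tau d.
Proof. by move=> dd; apply: ler_wiXn2l => //; lra. Qed.

(** The interiors of the new cells are disjoint from one another and from the
    lower skeleton, so the extensions can be chosen separately. *)
Let lift_step n (G : T -> X) (Th : T * R -> Y) : partial_lift n (G, Th) ->
  exists GT, partial_lift n.+1 GT /\ forall x, stage n x ->
    GT.1 x = G x /\ forall t, GT.2 (x, t) = Th (x, t).
Proof.
move=> GTn; have [/= GA Gq] := GTn.
have step j : exists GT : ('rV[R]_(dim j) -> X) * ('rV[R]_(dim j) * R -> Y),
    dim j = n -> [/\ cont_on cube GT.1, forall z, cube_bdry z -> GT.1 z = G (@q j z),
      cont_on (cube `*` @unit_itv R) GT.2,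
      forall z t, cube z -> 0 <= t <= tau n -> GT.2 (z, t) = f (GT.1 z) &
      (forall z, cube z -> GT.2 (z, 1) = phi (@q j z)) /\
      (forall z t, cube_bdry z -> 0 <= t <= 1 -> GT.2 (z, t) = Th (@q j z, t))].
  have [jn|jn] := pselect (dim j = n); last first.
    by exists (fun z => G (@q j z), fun p => Th (@q j p.1, p.2)).
  have [c1 c2] := cbdry_comp GTn jn.
  pose sg := 2 * tau n.
  have sg01 : 0 < sg < 1.
    have := tau_gt0 n; have : tau n < 2^-1; last by rewrite /sg => ? ?; apply/andP; split; lra.
    rewrite /tau exprS; have : 2^-1 ^+ n.+1 < 1 :> R by rewrite exprn_ilt1//; lra.
    lra.
  have bdA z : cube_bdry z -> A (@q j z) \/ exists k z', [/\ (dim k < n)%N, cube z' & @q k z' = @q j z].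
    have [F [_ Fdim qF]] := qfin j.
    move=> /qF[?|[k /Fdim kn [z' cz' e]]]; [by left|right].
    by exists k, z'; rewrite -jn.
  have := @cube_extension _ _ _ _ fcont fcomp _ _ Eh (dim j)
    (fun z => phi (@q j z)) (fun z => G (@q j z)) (fun p => Th (@q j p.1, p.2)) sg
    (cphi (j:=j)) c1 c2 sg01.
  case.
  - move=> z t /bdA /= [Az|[k [z' [kn cz' <-]]]] tt.
      have [-> ->//] := GA _ Az; first by rewrite fg0.
      by case/andP: tt sg01 => -> /= ? /andP[? ?]; lra.
    have [_ _ _ ->//] := Gq k kn.
    move/andP : tt => [-> /= tt]; apply: le_trans tt _.
    have := tau_le kn; have := tauS (dim k); rewrite /sg; lra.
  - move=> z /bdA /= [Az|[k [z' [kn cz' <-]]]].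
      by have [_ ->] := GA _ Az; rewrite ?ler01 ?lexx.
    by have [_ _ ->] := Gq k kn.
  - move=> Gj [Thj [g1 g2 g3 g4 g5]]; exists (Gj, Thj) => _; split=> //= z t cz tt.
    by apply: g4 => //; rewrite /sg (_ : 2 * tau n / 2 = tau n)//; field.
pose GG j := sval (cid (step j)).
have GGP j : dim j = n -> _ := svalP (cid (step j)).
pose P (p : pt) x := [/\ inner p, dim (projT1 p) = n & qq p = x].
pose G' x := if pselect (exists p, P p x) is left e then
  (GG (projT1 (sval (cid e)))).1 (projT2 (sval (cid e))) else G x.
pose Th' (xt : T * R) := if pselect (exists p, P p xt.1) is left e then
  (GG (projT1 (sval (cid e)))).2 (projT2 (sval (cid e)), xt.2) else Th xt.
have old x : stage n x -> G' x = G x /\ forall t, Th' (x, t) = Th (x, t).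
  move=> sx; rewrite /G' /Th' /=; case: pselect => // -[p [ip pn px]].
  by exfalso; apply: (stage_disj ip pn); rewrite px.
have new j z : dim j = n -> cube z ->
    G' (@q j z) = (GG j).1 z /\ forall t, 0 <= t <= 1 -> Th' (@q j z, t) = (GG j).2 (z, t).
  move=> jn cz; have [_ gb _ _ [_ tb]] := GGP j jn.
  have [zb|nzb] := pselect (cube_bdry z).
    have [|e1 e2] := old (@q j z).
      have [F [_ Fdim qF]] := qfin j.
      have [?|[k /Fdim kn [z' cz' e]]] := qF z zb; [by left|right].
      by exists k, z'; rewrite -jn.
    by rewrite e1 -gb//; split=> // t t01; rewrite e2 tb.
  have ex : exists p, P p (@q j z) by exists (existT _ j z); split.
  have pE : forall e : (exists p, P p (@q j z)), sval (cid e) = existT _ j z.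
    move=> e; case: (cid e) => p /= [ip pn px]; exact: qinj.
  by rewrite /G' /Th' /=; case: pselect => // e; rewrite pE.
exists (G', Th'); split=> //; split=> [x Ax|j] /=.
  have [|-> e2] := old x; first by left.
  by have [-> e3] := GA x Ax; split=> // t t01; rewrite e2 e3.
rewrite ltnS leq_eqVlt => /predU1P[jn|jn].
  have [g1 g2 g3 g4 [g5 g6]] := GGP j jn; split.
  - by apply: cont_on_eq g1 => z cz; have [->] := new j z jn cz.
  - apply: cont_on_eq g3 => -[z t] [cz t01] /=.
    by have [_ ->] := new j z jn cz.
  - by move=> z cz; have [_ ->] := new j z jn cz; rewrite ?g5 ?ler01 ?lexx.
  - move=> z t cz tt; have [-> ->] := new j z jn cz; first by apply: g4; rewrite // -jn.
    by case/andP: tt => -> /= /le_trans; apply; exact/ltW.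
have old' z : cube z -> G' (@q j z) = G (@q j z) /\ forall t, Th' (@q j z, t) = Th (@q j z, t).
  by move=> cz; apply: old; right; exists j, z.
have [g1 g2 g3 g4] := Gq j jn; split.
- by apply: cont_on_eq g1 => z cz; have [->] := old' z cz.
- apply: cont_on_eq g2 => -[z t] [cz t01] /=.
  by have [_ ->] := old' z cz.
- by move=> z cz; have [_ ->] := old' z cz; rewrite g3.
- by move=> z t cz tt; have [-> ->] := old' z cz; exact: g4.
Qed.

(** The lifts over the successive skeleta extend one another, so they fit
    together. *)
Theorem cell_extension : exists (G : T -> X) (Th : T * R -> Y),
  (forall x, A x -> G x = g0 x) /\
  forall j, [/\ cont_on cube (fun z => G (@q j z)),
      cont_on (cube `*` @unit_itv R) (fun p => Th (@q j p.1, p.2)),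
      forall z, cube z -> Th (@q j z, 1) = phi (@q j z) &
      forall z, cube z -> Th (@q j z, 0) = f (G (@q j z))].
Proof.
have start : partial_lift 0 (g0, fun p => phi p.1) by split.
pose st n := {GT | partial_lift n GT}.
have next n (s : st n) : {s' : st n.+1 | forall x, stage n x ->
    (sval s').1 x = (sval s).1 x /\ forall t, (sval s').2 (x, t) = (sval s).2 (x, t)}.
  case: s => -[G Th] s; have [GT' [s' e]] := cid (lift_step s).
  by exists (exist _ GT' s').
pose fix s n : st n :=
  if n is m.+1 then sval (next m (s m)) else exist _ _ start.
have sS n x : stage n x -> (sval (s n.+1)).1 x = (sval (s n)).1 x /\
    forall t, (sval (s n.+1)).2 (x, t) = (sval (s n)).2 (x, t).
  by move=> nx; exact: (svalP (next n (s n))).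
have stage_le m n x : (m <= n)%N -> stage m x -> stage n x.
  move=> mn [|[j [z [jm cz e]]]]; first by left.
  by right; exists j, z; rewrite (leq_trans jm).
have sle m n x : (m <= n)%N -> stage m x -> (sval (s n)).1 x = (sval (s m)).1 x /\
    forall t, (sval (s n)).2 (x, t) = (sval (s m)).2 (x, t).
  move=> mn mx; rewrite -(subnK mn); elim: (n - m)%N => // k [IH1 IH2].
  rewrite addSn; have [|e1 e2] := sS (k + m)%N x.
    by apply: stage_le mx; rewrite leq_addl.
  by rewrite e1 IH1; split=> // t; rewrite e2 IH2.
pose N x := xget 0%N [set n | stage n x].
pose G x := (sval (s (N x))).1 x.
pose Th (p : T * R) := (sval (s (N p.1))).2 p.
have GE n x : stage n x -> G x = (sval (s n)).1 x /\
    forall t, Th (x, t) = (sval (s n)).2 (x, t).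
  move=> nx; have NP : stage (N x) x by apply: (@xgetPex _ 0%N [set n | stage n x]); exists n.
  rewrite /G /Th /=; have [a1 a2] := sle _ _ _ (leq_maxl (N x) n) NP.
  have [b1 b2] := sle _ _ _ (leq_maxr (N x) n) nx.
  by rewrite -a1 b1; split=> // t; rewrite -a2 b2.
exists G, Th; split=> [x Ax|j].
  by have [|-> _] := GE 0%N x; first by left.
have jst z : cube z -> stage (dim j).+1 (@q j z) by move=> cz; right; exists j, z.
have [_ /(_ j (ltnSn _)) [g1 g2 g3 g4]] := svalP (s (dim j).+1).
split.
- by apply: cont_on_eq g1 => z cz; have [->] := GE _ _ (jst z cz).
- by apply: cont_on_eq g2 => -[z t] [cz _] /=; have [_ ->] := GE _ _ (jst z cz).
- by move=> z cz; have [_ ->] := GE _ _ (jst z cz); rewrite g3.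
- move=> z cz; have [-> ->] := GE _ _ (jst z cz); apply: g4 => //.
  by rewrite lexx ltW.
Qed.

End CellExtension.

(** * Cubes and Euclidean disks *)

Section CubeToBall.
Context (R : realType).
Implicit Types (x : nat -> R).

(** The triangular map [x |-> w] with [w i = x i * sqrt (1 - sum_(j < i) w j ^ 2)]
    of the cube [-1, 1]^d onto the unit ball. *)
Definition spread x (i : nat) : R := x i * Num.sqrt (\prod_(j < i) (1 - x j ^+ 2)).

Lemma spread_prod_ge0 x i : (forall j, (j < i)%N -> x j ^+ 2 <= 1) ->
  0 <= \prod_(j < i) (1 - x j ^+ 2).
Proof. by move=> h; apply: prodr_ge0 => j _; rewrite subr_ge0 h. Qed.

(** The product vanishes exactly on the boundary of the cube and is the defect
    of the image from the sphere. *)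
Lemma sum_sqr_spread x d : (forall j, (j < d)%N -> x j ^+ 2 <= 1) ->
  1 - \sum_(i < d) spread x i ^+ 2 = \prod_(i < d) (1 - x i ^+ 2).
Proof.
elim: d => [|d IH] h; first by rewrite !big_ord0 subr0.
have h' j : (j < d)%N -> x j ^+ 2 <= 1 by move=> jd; apply: h; exact: ltnW.
rewrite !big_ord_recr /= opprD addrA IH// /spread exprMn sqr_sqrtr.
  by rewrite mulrBr mulr1 (mulrC (x d ^+ 2)).
exact: spread_prod_ge0.
Qed.

Lemma spread_inj x x' d : (forall j, (j < d)%N -> x j ^+ 2 < 1) ->
  (forall i, (i < d)%N -> spread x i = spread x' i) ->
  forall i, (i < d)%N -> x i = x' i.
Proof.
move=> h e i; have [k] := ubnP i; elim: k => // k IH in i *.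
rewrite ltnS => ik id; have := e i id; rewrite /spread.
have -> : \prod_(j < i) (1 - x' j ^+ 2) = \prod_(j < i) (1 - x j ^+ 2).
  apply: eq_bigr => j _; rewrite -(IH j)//; first exact: leq_trans ik.
  exact: ltn_trans id.
apply: mulIf; rewrite gt_eqF// sqrtr_gt0; apply: prodr_gt0 => j _.
by rewrite subr_gt0 h// (ltn_trans _ id).
Qed.

Lemma spread_surj (y : nat -> R) d : \sum_(i < d) y i ^+ 2 < 1 ->
  exists2 x, (forall j, (j < d)%N -> x j ^+ 2 < 1) &
    forall i, (i < d)%N -> spread x i = y i.
Proof.
move=> yd; pose S i := \sum_(j < i) y j ^+ 2.
have S1 i : (i <= d)%N -> S i < 1.
  move=> id; apply: le_lt_trans yd; rewrite /S -(subnKC id) big_split_ord /=.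
  by rewrite lerDl; apply: sumr_ge0 => j _; exact: sqr_ge0.
have SS i : S i.+1 = S i + y i ^+ 2 by rewrite /S big_ord_recr.
pose x i := y i / Num.sqrt (1 - S i).
have x2 i : (i < d)%N -> x i ^+ 2 = y i ^+ 2 / (1 - S i).
  by move=> id; rewrite /x expr_div_n sqr_sqrtr// subr_ge0 ltW// S1// ltnW.
have xp i : (i <= d)%N -> \prod_(j < i) (1 - x j ^+ 2) = 1 - S i.
  elim: i => [|i IH] id; first by rewrite /S !big_ord0 subr0.
  rewrite big_ord_recr /= IH ?(ltnW id)// x2// SS.
  by field; rewrite subr_eq0 gt_eqF// S1// ltnW.
exists x => i id.
  rewrite x2// ltr_pdivrMr ?mul1r ?subr_gt0 ?S1 ?(ltnW id)//.
  by rewrite ltrBrDl -SS S1.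
rewrite /spread xp ?(ltnW id)// /x mulfVK// gt_eqF// sqrtr_gt0 subr_gt0 S1//.
exact: ltnW.
Qed.

Definition ball_coord d (z : 'rV[R]_d.+1) (j : nat) : R :=
  2 * z ord0 (inord j.+1) - 1.

(** The first coordinate is kept aside: it is the time when a cell is multiplied
    by the interval. *)
Definition ball_of_cube d (z : 'rV[R]_d.+1) : 'rV[R]_d :=
  \row_(i < d) spread (ball_coord z) i.

Lemma cont_on_ball_of_cube d A : cont_on A (@ball_of_cube d).
Proof.
have cc j : cont_on A (fun z : 'rV[R]_d.+1 => ball_coord z j).
  apply: cont_on_sub; last exact: cont_on_cst.
  by apply: cont_on_mul; [exact: cont_on_cst|exact: cont_on_coord].
apply: cont_on_row => i; apply: cont_on_mul => //.
apply: (@cont_on_comp _ _ _ A setT _ Num.sqrt) => //; last first.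
  by apply: cont_onT; exact: sqrt_continuous.
apply: cont_on_bigprod => j; apply: cont_on_sub; first exact: cont_on_cst.
by under eq_fun do rewrite expr2; exact: cont_on_mul.
Qed.

Lemma sqnorm_ball_of_cube d (z : 'rV[R]_d.+1) : cube z ->
  1 - sqnorm (ball_of_cube z) = \prod_(i < d) (1 - ball_coord z i ^+ 2).
Proof.
move=> cz; rewrite -sum_sqr_spread.
  by congr (_ - _); apply: eq_bigr => i _; rewrite mxE.
by move=> j _; have /andP[? ?] := cz (inord j.+1); rewrite /ball_coord; nra.
Qed.

Lemma ball_of_cube_disk d (z : 'rV[R]_d.+1) : cube z -> disk (ball_of_cube z).
Proof.
move=> cz; rewrite /disk/= -subr_ge0 sqnorm_ball_of_cube//.
apply: prodr_ge0 => i _.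
by have /andP[? ?] := cz (inord i.+1); rewrite /ball_coord; nra.
Qed.

Lemma ball_of_cube_sphere d (z : 'rV[R]_d.+1) (i : 'I_d) : cube z ->
  z ord0 (inord i.+1) = 0 \/ z ord0 (inord i.+1) = 1 -> sphere (ball_of_cube z).
Proof.
move=> cz zi; rewrite /sphere/=; apply/esym/eqP; rewrite -subr_eq0.
rewrite sqnorm_ball_of_cube//; apply/prodf_eq0; exists i => //.
by rewrite /ball_coord; case: zi => ->; apply/eqP; ring.
Qed.

Lemma ball_of_cube_inner d (z : 'rV[R]_d.+1) : (forall i, 0 < z ord0 i < 1) ->
  open_disk (ball_of_cube z).
Proof.
move=> cz; rewrite /open_disk/= -subr_gt0 sqnorm_ball_of_cube; last first.
  by move=> i; have /andP[? ?] := cz i; rewrite !ltW.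
apply: prodr_gt0 => i _.
by have /andP[? ?] := cz (inord i.+1); rewrite /ball_coord; nra.
Qed.

Lemma ball_of_cube_inj d (z z' : 'rV[R]_d.+1) :
  (forall i, 0 < z ord0 i < 1) -> z ord0 ord0 = z' ord0 ord0 ->
  ball_of_cube z = ball_of_cube z' -> z = z'.
Proof.
move=> cz z0 zz'; apply/rowP => i; have [->//|i0] := eqVneq i ord0.
have ip : (0 < i)%N by rewrite lt0n.
have id : (i.-1 < d)%N by rewrite -ltnS prednK.
have := @spread_inj (ball_coord z) (ball_coord z') d _ _ i.-1 id.
rewrite /ball_coord prednK// inord_val => H.
suff : 2 * z ord0 i - 1 = 2 * z' ord0 i - 1 by lra.
apply: H => j jd.
  by have /andP[? ?] := cz (inord j.+1); nra.
by move/rowP/(_ (Ordinal jd)) : zz'; rewrite !mxE.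
Qed.

Lemma ball_of_cube_surj d (y : 'rV[R]_d) (t : R) : open_disk y -> 0 <= t <= 1 ->
  exists z : 'rV[R]_d.+1, [/\ cube z, z ord0 ord0 = t & ball_of_cube z = y].
Proof.
move=> yd t01; pose y' (i : nat) : R := if insub i is Some j then y ord0 j else 0.
have y'E (i : 'I_d) : y' i = y ord0 i by rewrite /y' valK.
have [|x x1 xy] := @spread_surj y' d.
  by rewrite (eq_bigr (fun i => y ord0 i ^+ 2))// => i _; rewrite y'E.
pose z : 'rV[R]_d.+1 := \row_i (if i == ord0 then t else (x i.-1 + 1) / 2).
have bz j : (j < d)%N -> ball_coord z j = x j.
  move=> jd; rewrite /ball_coord mxE; have jv : (inord j.+1 : 'I_d.+1) = j.+1 :> nat.
    by rewrite inordK.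
  rewrite ifF; last by apply/negbTE; rewrite -val_eqE /= jv.
  by rewrite jv /=; field.
exists z; split.
- move=> i; rewrite mxE; case: eqVneq => // i0.
  have ip : (0 < i)%N by rewrite lt0n.
  have /x1 : (i.-1 < d)%N by rewrite -ltnS prednK.
  by move=> ?; apply/andP; split; nra.
- by rewrite mxE eqxx.
- apply/rowP => i; rewrite mxE -y'E -xy// /spread bz//; congr (_ * Num.sqrt _).
  by apply: eq_bigr => j _; rewrite bz// (ltn_trans _ (ltn_ord i)).
Qed.

Lemma ball_of_cube_time d (z : 'rV[R]_d.+1) (t : R) : cube z -> 0 <= t <= 1 ->
  exists z', [/\ cube z', z' ord0 ord0 = t & ball_of_cube z' = ball_of_cube z].
Proof.
move=> cz t01; pose z' : 'rV[R]_d.+1 := \row_i (if i == ord0 then t else z ord0 i).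
exists z'; split.
- by move=> i; rewrite mxE; case: ifP.
- by rewrite mxE eqxx.
- have zz' j : (j < d)%N -> ball_coord z' j = ball_coord z j.
    move=> jd; rewrite /ball_coord mxE ifF//; apply/negbTE.
    by rewrite -val_eqE /= inordK.
  apply/rowP => i; rewrite !mxE /spread zz'//; congr (_ * Num.sqrt _).
  by apply: eq_bigr => j _; rewrite zz'// (ltn_trans _ (ltn_ord i)).
Qed.

End CubeToBall.

(** * The cells of a complex times the interval *)

Section CellsTimesInterval.
Context (R : realType) (K : topologicalType) (c : cw_structure R K).
Local Notation J := (cw_index c).

Definition tcell (j : J) (z : 'rV[R]_((cw_dim j).+1)) : K * R :=
  (cw_map (ball_of_cube z), z ord0 ord0).

Lemma cont_on_tcell j : cont_on cube (@tcell j).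
Proof.
apply: cont_on_pair; last exact: cont_on_coord.
apply: (@cont_on_comp _ _ _ _ (@disk R (cw_dim j)) (@ball_of_cube R (cw_dim j)) (@cw_map R K c j)).
- exact: cont_on_ball_of_cube.
- by move=> z; exact: ball_of_cube_disk.
- by apply/cont_onP; exact: cw_map_continuous.
Qed.

Definition ends : set (K * R) := [set p | p.2 = 0 \/ p.2 = 1].

Lemma closed_ends : closed ends.
Proof.
apply: closedU.
  by apply: closed_eq_fun; [exact: cont_on_snd|exact: cont_on_cst].
by apply: closed_eq_fun; [exact: cont_on_snd|exact: cont_on_cst].
Qed.

Lemma tcell_inj (p p' : {j : J & 'rV[R]_((cw_dim j).+1)}) :
  open_cube (projT2 p) -> open_cube (projT2 p') ->
  tcell (projT2 p) = tcell (projT2 p') -> p = p'.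
Proof.
case: p p' => j z [j' z'] /=; rewrite !cube_innerP => iz iz' [e t].
have jj' : j = j'.
  apply: (@cw_disjoint _ _ c) => //; exists (cw_map (ball_of_cube z)); split.
    by exists (ball_of_cube z) => //; exact: ball_of_cube_inner.
  by rewrite e; exists (ball_of_cube z') => //; exact: ball_of_cube_inner.
subst j'; congr existT; apply: ball_of_cube_inj => //.
have [inj _ _] := @cw_map_embedding _ _ c j.
have d1 := mem_set (ball_of_cube_inner iz).
have d2 := mem_set (ball_of_cube_inner iz').
by have /(congr1 val) /= := inj (SigSub d1) (SigSub d2) e.
Qed.

Lemma tcell_bdry (j : J) : exists F : set J, [/\ finite_set F,
  forall k, F k -> ((cw_dim k).+1 < (cw_dim j).+1)%N &
  forall z, cube_bdry z -> ends (@tcell j z) \/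
    exists2 k, F k & (@tcell k @` cube) (tcell z)].
Proof.
have [F [finF dF] Fs] := @cw_closure_finite _ _ c j.
exists F; split=> // z [cz [i [_ zi]]].
have [i0|i0] := eqVneq i ord0; first by left; subst i.
right; have ip : (0 < i)%N by rewrite lt0n.
have id : (i.-1 < cw_dim j)%N by rewrite -ltnS prednK.
have sz : sphere (ball_of_cube z).
  apply: (@ball_of_cube_sphere _ _ _ (Ordinal id)) => //=.
  by rewrite prednK// inord_val.
have [|k Fk [y yd e]] := Fs (cw_map (ball_of_cube z)); first by exists (ball_of_cube z).
exists k => //; have [z' [cz' zt zb]] := ball_of_cube_surj yd (cz ord0).
by exists z' => //; rewrite /tcell zb e zt.
Qed.

(** The image of the compact cube is closed, so it contains the closure of the
    open cell. *)
Lemma tcell_cover (j : J) k t : closure (cw_cell j) k -> 0 <= t <= 1 ->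
  exists2 z : 'rV[R]_((cw_dim j).+1), cube z & tcell z = (k, t).
Proof.
move=> kj t01.
pose m (z : 'rV[R]_((cw_dim j).+1)) := (tcell z).1.
have cm : closed (m @` cube).
  apply: compact_closed; first exact: (cw_hausdorff c).
  apply: continuous_compact; last exact: box_compact.
  apply/cont_onP; apply: (@cont_on_comp _ _ _ _ setT (@tcell j) fst) => //.
    exact: cont_on_tcell.
  exact: cont_on_fst.
have : (m @` cube) k.
  apply: cm; apply: closureS kj => _ [y yd <-].
  by have [z [cz _ zy]] := ball_of_cube_surj yd t01; exists z => //; rewrite /m /= zy.
move=> [z cz <-]; have [z' [cz' zt zb]] := ball_of_cube_time cz t01.
by exists z' => //; rewrite /m /tcell zb zt.
Qed.

Lemma tcell_cover_all k t : 0 <= t <= 1 ->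
  exists j (z : 'rV[R]_((cw_dim j).+1)), cube z /\ tcell z = (k, t).
Proof.
move=> t01; have : [set: K] k by []. 
rewrite -(cw_cover c) => -[j _ kj].
have [z cz e] := tcell_cover (subset_closure kj) t01.
by exists j, z.
Qed.

(** The product of a complex with the interval has the weak topology of its
    cells, because the interval is locally compact: the points [k] such that [G]
    maps all [(k, t)], with [t] in a compact neighborhood of [t0], into an open
    set form an open set, their complement meeting each closed cell in the image
    of a compact set. *)
Lemma tcell_weak (Z : topologicalType) (G : K * R -> Z) :
  (forall j, cont_on cube (fun z => G (@tcell j z))) ->
  cont_on (setT `*` @unit_itv R) G.
Proof.
move=> cG [k0 t0] [_ /= t01] O; rewrite nbhsE => -[O' [oO' O'x] O'O].
pose D (j : J) e := cube `&` [set z : 'rV[R]_((cw_dim j).+1) | `|z ord0 ord0 - t0| <= e].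
have cD j e : compact (D j e).
  apply: compact_closedI; first exact: box_compact.
  apply: closed_le_fun; last exact: cont_on_cst.
  apply: cont_on_abs; apply: cont_on_sub; last exact: cont_on_cst.
  exact: cont_on_coord.
have [e e0 eO] : exists2 e, 0 < e & forall t, 0 <= t <= 1 -> `|t - t0| <= e -> O' (G (k0, t)).
  have [j [z [cz zk]]] := tcell_cover_all k0 t01.
  pose zz t : 'rV[R]_((cw_dim j).+1) := \row_i (if i == ord0 then t else z ord0 i).
  have zzE t : tcell (zz t) = (k0, t).
    rewrite /tcell mxE eqxx; congr (_, _); case: zk => <- _; congr cw_map.
    have bE i : (i < cw_dim j)%N -> ball_coord (zz t) i = ball_coord z i.
      move=> id; rewrite /ball_coord mxE ifF//; apply/negbTE.
      by rewrite -val_eqE /= inordK.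
    apply/rowP => i; rewrite !mxE /spread bE//; congr (_ * Num.sqrt _).
    by apply: eq_bigr => i' _; rewrite bE// (ltn_trans _ (ltn_ord i)).
  have czz t : 0 <= t <= 1 -> cube (zz t).
    by move=> tt i; rewrite mxE; case: ifP.
  have : cont_on (@unit_itv R) (fun t => G (tcell (zz t))).
    apply: (@cont_on_comp _ _ _ _ cube zz (fun z => G (tcell z))) => //.
    apply: cont_on_row => i; case: eqP => _; first exact: cont_on_id.
    exact: cont_on_cst.
  move=> /(_ t0 t01 O'); case.
    by apply: open_nbhs_nbhs; split=> //; rewrite zzE.
  move=> e /= e0 H; exists (e / 2) => [|t tt te]; first by rewrite divr_gt0.
  rewrite -zzE; apply: H => //=; rewrite distrC (le_lt_trans te)//.
  by move: e0; lra.
pose W := [set k | forall t, 0 <= t <= 1 -> `|t - t0| <= e -> O' (G (k, t))].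
have cW : closed (~` W).
  apply/(cw_weak c) => j.
  pose C := D j e `&` (fun z => G (tcell z)) @^-1` (~` O').
  have cC : compact C.
    apply: compact_preimage => //; last exact: open_closedC.
    by apply: cont_onS (cG j) => z [].
  rewrite (_ : ~` W `&` _ = ((fun z => (@tcell j z).1) @` C) `&` closure (cw_cell j)).
    apply: closedI; last exact: closed_closure.
    apply: compact_closed; first exact: (cw_hausdorff c).
    apply: continuous_compact => //; apply/cont_onP.
    apply: (@cont_on_comp _ _ _ _ setT (@tcell j) fst) => //.
      by apply: cont_onS (@cont_on_tcell j) => z [[]].
    exact: cont_on_fst.
  apply/seteqP; split=> k [h1 h2]; split=> //.
    move/existsNP : h1 => [t /not_implyP[tt /not_implyP[te nO]]].
    have [z cz zk] := tcell_cover h2 tt.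
    exists z; last by rewrite zk.
    split; last by rewrite /= zk.
    by split=> //=; case: zk => _ ->.
  case: h1 => z [[cz ze] nO] <- kW; apply: nO.
  have := kW (z ord0 ord0) (cz ord0) ze; exact.
have nW : nbhs k0 W.
  apply: open_nbhs_nbhs; split; last exact: eO.
  by rewrite -(setCK W); exact: closed_openC.
exists (W, ball t0 e); first by split=> //=; exact: nbhsx_ballx.
move=> [k t] [/= kW te] [_ /= tt]; apply: O'O; apply: kW => //.
by rewrite distrC ltW.
Qed.

End CellsTimesInterval.

(** The homotopy between the composites is lifted over the product of [K] and
    the interval, relatively to the two ends. *)
Lemma homotopic_lift (R : realType) (X : topologicalType) (Y : metricType R)
    (f : X -> Y) (K : topologicalType) (c : cw_structure R K) (u v : K -> X) (y0 : Y) :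
  absolute_neighborhood_retract Y -> continuous f -> compressive R f ->
  continuous u -> continuous v ->
  homotopic R (fun k => f (u k)) (fun k => f (v k)) -> homotopic R u v.
Proof.
move=> anrY fcont fcomp cu cv /homotopicIE[phi [cphi phi0 phi1]]; apply/homotopicIE.
have [E [h Eh]] := locally_equiconnected y0 anrY.
pose g0 (p : K * R) := if p.2 == 0 then u p.1 else v p.1.
have hTR : hausdorff_space (K * R)%type.
  by apply: hausdorff_prod; [exact: (cw_hausdorff c)|exact: Rhausdorff].
have cg0 : cont_on (@ends R K) g0.
  apply: (@cont_on_glue2 _ _ _ [set p : K * R | p.2 = 0] [set p : K * R | p.2 = 1]).
  - by apply: closed_eq_fun; [exact: cont_on_snd|exact: cont_on_cst].
  - by apply: closed_eq_fun; [exact: cont_on_snd|exact: cont_on_cst].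
  - by move=> p.
  - apply: (@cont_on_eq _ _ _ (fun p => u p.1)).
      by move=> p [_ /= e]; rewrite /g0 e eqxx.
    apply: (@cont_on_comp _ _ _ _ setT fst u) => //; first exact: cont_on_fst.
    exact: cont_onT.
  - apply: (@cont_on_eq _ _ _ (fun p => v p.1)).
      by move=> p [_ /= e]; rewrite /g0 e oner_eq0.
    apply: (@cont_on_comp _ _ _ _ setT fst v) => //; first exact: cont_on_fst.
    exact: cont_onT.
have qA (j : cw_index c) (z : 'rV[R]_((cw_dim j).+1)) :
    open_cube z -> ~ ends (tcell z).
  rewrite cube_innerP => /(_ ord0) /= + e.
  by case: e => /= ->; rewrite ltxx ?andbF.
have := @cell_extension _ _ _ _ fcont fcomp _ _ Eh _ (@ends R K) _
  (fun j => (cw_dim j).+1) (@tcell R K c) hTR (@closed_ends R K)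
  (@cont_on_tcell R K c) (@tcell_inj R K c) qA (@tcell_bdry R K c) phi g0.
case.
- move=> j; apply: (@cont_on_comp _ _ _ _ (setT `*` @unit_itv R) (@tcell R K c j) phi) => //.
    exact: cont_on_tcell.
  by move=> z cz; split => //=; exact: cz.
- exact: cg0.
- by apply: cont_onS cphi => p [] e; split=> //; rewrite /unit_itv/= e ?lexx ler01.
- by move=> [k t] [/= ->|/= ->]; rewrite /g0 /= ?eqxx ?oner_eq0 ?phi0 ?phi1.
move=> G [Th [GA Gq]]; exists G; split.
- by apply: (tcell_weak (c := c)) => j; have [] := Gq j.
- by move=> k; rewrite GA; [rewrite /g0/= eqxx|left].
- by move=> k; rewrite GA; [rewrite /g0/= oner_eq0|right].
Qed.

(** * The cubical nerve of a cover by balls *)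

Lemma cont_on_ptws (R : realType) (S : topologicalType) (Y : topologicalType) (A : set S)
    (F : S -> {ptws Y -> R}) :
  (forall a, cont_on A (fun x => F x a)) -> cont_on A F.
Proof.
move=> cF; apply/cont_on_cvg => x Ax.
apply/(@pointwise_cvgP Y R (F @ within A (nbhs x)) (F x)) => a.
by have /cont_on_cvg := cF a; exact.
Qed.

Lemma ptws_hausdorff (R : realType) (Y : topologicalType) : hausdorff_space {ptws Y -> R}.
Proof.
move=> p q pq; apply/funext => a; apply: (@Rhausdorff R) => A B Ap Bq.
have c : continuous (fun x : {ptws Y -> R} => x a).
  by apply: (@proj_continuous Y (fun=> R) a).
have cA : nbhs p ((fun x : {ptws Y -> R} => x a) @^-1` A) by exact: (c p).
have cB : nbhs q ((fun x : {ptws Y -> R} => x a) @^-1` B) by exact: (c q).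
by have [z [Az Bz]] := pq _ _ cA cB; exists (z a).
Qed.

Section Nerve.
Context (R : realType) (Y : metricType R) (delta : Y -> R).

(** A face of the cubical nerve of the cover by the balls of centre [a] and
    radius [delta a]: the coordinates in [ones] are 1, those in [free] vary in
    [0, 1] and the others vanish.  The nerve consists of the functions on [Y] with
    values in [0, 1] that are 1 somewhere and whose support is a finite set of
    centres of balls with a common point; it subdivides the simplicial nerve into cubes. *)
Record ncell := NCell {
  ones : {fset Y};
  free : {fset Y};
  ncellP : [/\ forall a, a \in ones -> a \notin free, exists a, a \in ones &
    exists y, forall a, (a \in ones) || (a \in free) -> mdist a y < delta a]
}.

Lemma ncell_eq (j k : ncell) : ones j = ones k -> free j = free k -> j = k.
Proof.
case: j k => o f P [o' f' P'] /= oo ff; subst o' f'; congr NCell.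
exact: Prop_irrelevance.
Qed.

Definition ncoord (j : ncell) (z : 'rV[R]_(#|` free j|)) (a : Y) : R :=
  if a \in ones j then 1 else oapp (fun i => z ord0 i) 0 (insub (index a (free j))).

Lemma ncoord_one j z a : a \in ones j -> @ncoord j z a = 1.
Proof. by rewrite /ncoord => ->. Qed.

Lemma ncoord_zero j z a : a \notin ones j -> a \notin free j -> @ncoord j z a = 0.
Proof.
move=> /negbTE h n; rewrite /ncoord h insubF//; apply/negbTE.
by rewrite index_mem.
Qed.

Lemma ncoord_free j a : a \in free j -> exists i, forall z, @ncoord j z a = z ord0 i.
Proof.
move=> af; have ai : (index a (free j) < #|` free j|)%N by rewrite index_mem.
exists (Ordinal ai) => z; rewrite /ncoord ifF ?insubT//.
by apply/negbTE; have [h _ _] := ncellP j; apply: contraL af; exact: h.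
Qed.

Lemma ncoord_nth j i : exists2 a, a \in free j & forall z, @ncoord j z a = z ord0 i.
Proof.
pose a := tnth (in_tuple (free j)) i; exists a; first exact: mem_tnth.
have af : a \in free j by exact: mem_tnth.
have ia : index a (free j) = i.
  rewrite /a (tnth_nth a) /= index_uniq//; exact: fset_uniq.
move=> z; rewrite /ncoord ifF ?ia ?valK//.
by apply/negbTE; have [h _ _] := ncellP j; apply: contraL af; exact: h.
Qed.

(** The parameter of a point of the face [j]. *)
Definition nproj (j : ncell) (x : Y -> R) : 'rV[R]_(#|` free j|) :=
  \row_i x (tnth (in_tuple (free j)) i).

Definition on_face (j : ncell) (x : Y -> R) :=
  (forall a, a \in ones j -> x a = 1) /\
  (forall a, a \notin ones j -> a \notin free j -> x a = 0).

Lemma nprojK j x : on_face j x -> ncoord (nproj j x) = x.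
Proof.
move=> [x1 x0]; apply/funext => a; have [ao|ao] := boolP (a \in ones j).
  by rewrite ncoord_one// x1.
have [af|af] := boolP (a \in free j); last by rewrite ncoord_zero// x0.
have ai : (index a (free j) < #|` free j|)%N by rewrite index_mem.
rewrite /ncoord (negbTE ao) insubT /= mxE (tnth_nth a) /=.
by rewrite nth_index.
Qed.

Lemma nproj_cube j x : (forall a, 0 <= x a <= 1) -> cube (nproj j x).
Proof. by move=> x01 i; rewrite mxE. Qed.

Lemma on_face_ncoord j z : on_face j (@ncoord j z).
Proof. by split=> a; [exact: ncoord_one|exact: ncoord_zero]. Qed.

Lemma ncoord01 j z a : cube z -> 0 <= @ncoord j z a <= 1.
Proof.
move=> cz; have [ao|ao] := boolP (a \in ones j); first by rewrite ncoord_one// ler01 lexx.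
have [/ncoord_free[i ->]//|af] := boolP (a \in free j).
by rewrite ncoord_zero// lexx ler01.
Qed.

Lemma cont_on_ncoord j a : cont_on cube (fun z => @ncoord j z a).
Proof.
have [ao|ao] := boolP (a \in ones j).
  by apply: (@cont_on_eq _ _ _ (fun=> 1 : R)) => [z _|]; [rewrite ncoord_one|exact: cont_on_cst].
have [/ncoord_free[i e]|af] := boolP (a \in free j).
  by apply: (@cont_on_eq _ _ _ (fun z : 'rV[R]_(#|` free j|) => z ord0 i)) => [z _|]; [rewrite e|exact: cont_on_coord].
by apply: (@cont_on_eq _ _ _ (fun=> 0 : R)) => [z _|]; [rewrite ncoord_zero|exact: cont_on_cst].
Qed.

Lemma ncoord_inner j z : open_cube z ->
  (forall a, (a \in ones j) = (@ncoord j z a == 1)) /\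
  (forall a, (a \in free j) = (0 < @ncoord j z a < 1)).
Proof.
rewrite cube_innerP => iz.
have fr a : a \in free j -> 0 < ncoord z a < 1 by move=> /ncoord_free[i ->].
split=> a.
  have [ao|ao] := boolP (a \in ones j); first by rewrite ncoord_one// eqxx.
  have [/fr/andP[_ /lt_eqF->]//|af] := boolP (a \in free j).
  by rewrite ncoord_zero// eq_sym oner_eq0.
have [/fr->//|af] := boolP (a \in free j).
have [ao|ao] := boolP (a \in ones j); first by rewrite ncoord_one// ltxx andbF.
by rewrite ncoord_zero// ltxx.
Qed.

Lemma ncoord_inj (p p' : {j : ncell & 'rV[R]_(#|` free j|)}) :
  open_cube (projT2 p) -> open_cube (projT2 p') ->
  ncoord (projT2 p) = ncoord (projT2 p') -> p = p'.
Proof.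
case: p p' => j z [j' z'] /= /ncoord_inner[o f] /ncoord_inner[o' f'] e.
have jj' : j = j'.
  by apply: ncell_eq; apply/fsetP => a; rewrite ?o ?o' ?f ?f' e.
subst j'; congr existT; apply/rowP => i.
by have [a _ ai] := ncoord_nth i; rewrite -!ai e.
Qed.

Lemma ncells_finite (F : {fset Y}) :
  finite_set [set j : ncell | (ones j `|` free j `<=` F)%fset].
Proof.
pose v (j : ncell) := (ones j, free j).
apply: (@sub_finite_set _ _ (v @^-1` ([set` fpowerset F] `*` [set` fpowerset F]))).
  move=> j /=; rewrite fsubUset => /andP[oF fF].
  by split; rewrite /= fpowersetE.
apply: finite_preimage; last exact: finite_setX.
by move=> j k _ _ [? ?]; exact: ncell_eq.
Qed.

Lemma own_face (x : Y -> R) (F : {fset Y}) : (forall a, 0 <= x a <= 1) ->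
  (forall a, x a != 0 -> a \in F) -> (exists a, x a = 1) ->
  (exists y, forall a, x a != 0 -> mdist a y < delta a) ->
  exists j : ncell, [/\ on_face j x, (ones j `|` free j `<=` F)%fset,
    forall a, a \in ones j -> x a = 1 & forall a, a \in free j -> 0 < x a < 1].
Proof.
move=> x01 xF [a1 xa1] [y xy].
pose o := [fset a in F | x a == 1]%fset; pose fr := [fset a in F | 0 < x a < 1]%fset.
have oE a : (a \in o) = (x a == 1).
  by rewrite !inE /= andb_idl// => /eqP e; apply: xF; rewrite e oner_neq0.
have fE a : (a \in fr) = (0 < x a < 1).
  by rewrite !inE /= andb_idl// => /andP[x0 _]; apply: xF; rewrite gt_eqF.
have P : [/\ forall a, a \in o -> a \notin fr, exists a, a \in o &
    exists y, forall a, (a \in o) || (a \in fr) -> mdist a y < delta a].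
  split; first by move=> a; rewrite oE fE => /eqP->; rewrite ltxx andbF.
    by exists a1; rewrite oE xa1.
  exists y => a; rewrite oE fE => h; apply: xy.
  by case/orP: h => [/eqP->|/andP[x0 _]]; rewrite ?oner_neq0// gt_eqF.
exists (NCell P); split => /=.
- split=> a; rewrite /= oE; first by move=> /eqP.
  rewrite fE => x1; have /andP[h0 h1] := x01 a.
  rewrite (lt_neqAle (x a)) x1 h1 /= andbT lt_neqAle h0 andbT negbK => /eqP e.
  exact/esym.
- by apply/fsubsetP => a; rewrite !inE /= => /orP[]/andP[].
- by move=> a; rewrite oE => /eqP.
- by move=> a; rewrite fE.
Qed.

(** A point of the boundary of a face lies on the face given by its own
    coordinates, where fewer of them are free. *)
Lemma ncoord_bdry (j : ncell) : exists F : set ncell, [/\ finite_set F,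
  forall k, F k -> (#|` free k| < #|` free j|)%N &
  forall z, cube_bdry z ->
    exists2 k, F k & (@ncoord k @` cube) (@ncoord j z)].
Proof.
exists [set k : ncell | (ones k `|` free k `<=` ones j `|` free j)%fset /\
  (#|` free k| < #|` free j|)%N]; split.
- have := @ncells_finite (ones j `|` free j)%fset; apply: sub_finite_set.
  by move=> k [].
- by move=> k [].
move=> z [cz [i [_ zi]]]; pose x := @ncoord j z.
have [o0 [a1 a1o] [y jy]] := ncellP j.
have nz a : x a != 0 -> (a \in ones j) || (a \in free j).
  by apply: contra_neqT; rewrite negb_or => /andP[? ?]; exact: ncoord_zero.
have [k [kx kj k1 kf]] : exists k : ncell, [/\ on_face k x,
    (ones k `|` free k `<=` ones j `|` free j)%fset,
    forall a, a \in ones k -> x a = 1 & forall a, a \in free k -> 0 < x a < 1].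
  apply: own_face.
  - by move=> a; exact: ncoord01.
  - by move=> a /nz; rewrite !inE.
  - by exists a1; exact: ncoord_one.
  - by exists y => a /nz; exact: jy.
exists k; last first.
  exists (nproj k x); last exact: nprojK.
  by apply: nproj_cube => a; exact: ncoord01.
split=> //; have [a af ai] := ncoord_nth i.
apply: fproper_ltn_card; rewrite fproperE; apply/andP; split.
  apply/fsubsetP => b bk.
  have := kf b bk; have [bf//|bf] := boolP (b \in free j).
  have [bo|bo] := boolP (b \in ones j); rewrite /x.
    by rewrite ncoord_one// ltxx andbF.
  by rewrite ncoord_zero// ltxx.
apply/negP => /fsubsetP/(_ a af) /kf; rewrite /x ai.
by case: zi => ->; rewrite ltxx ?andbF.
Qed.

End Nerve.

(** * A homotopy section *)

Lemma barycentre_near (R : realType) (Y : metricType R) (s : seq Y)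
    (z : Y -> R) (b : Y) (d : R) :
  (forall a, 0 <= z a) -> 0 < \sum_(a <- s) z a ->
  (forall a, a \in s -> z a != 0 -> mdist b a <= d) ->
  forall w, `|barycentre s z w - mdist b w| <= d.
Proof.
move=> z0 S0 near w; set S := \sum_(a <- s) z a in S0 *.
have -> : barycentre s z w - mdist b w =
    (\sum_(a <- s) z a * (mdist a w - mdist b w)) / S.
  under [in RHS]eq_bigr do rewrite mulrBr.
  rewrite sumrB -mulr_suml -/S /barycentre mulrBl mulrAC divff ?mul1r//.
  by rewrite gt_eqF.
rewrite normrM normfV (gtr0_norm S0) ler_pdivrMr//.
rewrite (le_trans (ler_norm_sum _ _ _))// /S mulr_sumr.
rewrite big_seq [leRHS]big_seq; apply: ler_sum => a as_.
rewrite normrM ger0_norm// mulrC.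
have [->|za] := eqVneq (z a) 0; first by rewrite !mulr0.
apply: ler_wpM2r => //; apply: le_trans (near a as_ za).
have := metric_triangle a b w; have := metric_triangle b a w.
by rewrite (metric_sym a b) ler_norml => ? ?; apply/andP; split; lra.
Qed.

Lemma barycentre_support (R : realType) (Y : metricType R) (S F : {fset Y})
    (z : Y -> R) :
  (S `<=` F)%fset -> (forall a, z a != 0 -> a \in S) ->
  barycentre S z = barycentre F z.
Proof.
move=> SF zS; apply/funext => w; rewrite /barycentre.
have z0 a : a \in F -> a \notin S -> z a = 0.
  by move=> _; apply: contraNeq; exact: zS.
by congr (_ / _); apply: big_fset_incl => // a aF aS; rewrite z0// mul0r.
Qed.

Section HomotopySection.
Context (R : realType) (X : topologicalType) (Y : metricType R) (f : X -> Y).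

(** The cover consists of balls of half the radius [delta a] within which convex
    combinations can be retracted to [Y].  The centres of balls with a common
    point are then within [delta b] of the centre [b] of the largest of them. *)
Lemma homotopy_section (y0 : Y) : absolute_neighborhood_retract Y ->
  continuous f -> compressive R f ->
  exists2 g : Y -> X, continuous g & homotopicI R (fun y => f (g y)) id.
Proof.
move=> anrY fcont fcomp.
have [E [h Eh]] := locally_equiconnected y0 anrY.
have [U [r [rid Unear Ukat rcont]]] := anr_katetov_retract y0 anrY.
have [x0 _ _] := fcomp.1 y0 I.
have retr_cont (S : topologicalType) (D : set S) (F : S -> Y -> R) :
    supcont D F -> (forall x, D x -> U (F x)) -> cont_on D (fun x => r (F x)).
  move=> cF FU; apply: cont_on_metric => x Dx e e0.
  have [d d0 dr] := rcont _ (FU x Dx) e e0.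
  have := cF x Dx d d0; apply: filterS => x' hx Dx'; apply: dr; first exact: FU.
  exact: hx.
have [delta dP] : {delta : Y -> R | forall b, 0 < delta b /\ forall F, katetov F ->
    (forall w, `|F w - mdist b w| <= delta b) -> U F}.
  have H b := cid2 (Unear b).
  by exists (fun b => s2val (H b)) => b; split; [exact: (s2valP (H b))|exact: (s2valP' (H b))].
pose dh b := delta b / 2.
have dh0 b : 0 < dh b by rewrite divr_gt0//; have [] := dP b.
(* [b] is the centre of the largest of the balls that occur *)
have centre (F : {fset Y}) (x : Y -> R) y : (forall a, 0 <= x a) ->
    (forall a, x a != 0 -> a \in F) -> (exists a, x a != 0) ->
    (forall a, x a != 0 -> mdist a y < dh a) ->
    0 < \sum_(a <- F) x a /\ exists b, mdist b y < delta b /\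
      forall w, `|barycentre F x w - mdist b w| <= delta b.
  move=> xp xF [a1 xa1] xy.
  have S0 : 0 < \sum_(a <- F) x a.
    rewrite (big_fsetD1 a1) /=; last exact: xF.
    by rewrite ltr_pwDl ?sumr_ge0// lt_neqAle eq_sym xa1 xp.
  split=> //; have [b bs bmax] : exists2 b, b \in [seq a <- F | x a != 0] &
      forall a, a \in [seq a <- F | x a != 0] -> dh a <= dh b.
    by apply: (@seq_max _ _ _ _ a1); rewrite mem_filter xa1 xF.
  move: bs; rewrite mem_filter => /andP[xb bF].
  exists b; split.
    by have := xy b xb; have := dh0 b; rewrite /dh; lra.
  apply: barycentre_near => // a aF xa.
  have := bmax a; rewrite mem_filter xa aF => /(_ isT).
  have := xy a xa; have := xy b xb; have := metric_triangle b y a.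
  by rewrite (metric_sym y a) /dh; lra.
have centreU F x y t : (forall a, 0 <= x a) ->
    (forall a, x a != 0 -> a \in F) -> (exists a, x a != 0) ->
    (forall a, x a != 0 -> mdist a y < dh a) -> 0 <= t <= 1 ->
    U (fun w => (1 - t) * barycentre (F : {fset Y}) x w + t * mdist y w).
  move=> xp xF x1 xy t01; have [S0 [b [by_ bn]]] := centre F x y xp xF x1 xy.
  have [_] := dP b; apply.
    apply: katetov_conv => //; [exact: katetov_barycentre|exact: katetov_mdist].
  move=> w; have := bn w; have := metric_triangle b y w; have := metric_triangle y b w.
  rewrite (metric_sym y b); move: t01 => /andP[t0 t1] k1 k2.
  by rewrite !ler_norml => /andP[k3 k4]; apply/andP; split; nra.
have baryU (F : {fset Y}) (x : Y -> R) y : (forall a, 0 <= x a) ->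
    (forall a, x a != 0 -> a \in F) -> (exists a, x a != 0) ->
    (forall a, x a != 0 -> mdist a y < dh a) -> U (barycentre F x).
  move=> xp xF x1 xy; have := centreU F x y 0 xp xF x1 xy.
  rewrite lexx ler01 => /(_ isT); congr U; apply/funext => w; ring.
pose supp (x : {ptws Y -> R}) := fset_set [set a | x a != 0].
pose phi (x : {ptws Y -> R}) : Y := r (barycentre (supp x) x).
have suppE (F : {fset Y}) (x : Y -> R) : (forall a, x a != 0 -> a \in F) ->
    barycentre (supp x) x = barycentre F x.
  move=> xF; have fin : finite_set [set a | x a != 0].
    by apply: sub_finite_set (finite_fset F) => a /= /xF.
  apply: barycentre_support => [|a xa].
    by apply/fsubsetP => a; rewrite in_fset_set// => /set_mem/xF.
  by rewrite in_fset_set//; exact/mem_set.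
have nzF (j : ncell dh) (x : Y -> R) a : on_face j x -> x a != 0 -> a \in (ones j `|` free j)%fset.
  move=> [_ x0']; apply: contra_neqT; rewrite inE negb_or => /andP[? ?].
  exact: x0'.
have cnc (j : ncell dh) : cont_on cube (@ncoord R Y dh j : _ -> {ptws Y -> R}).
  by apply: cont_on_ptws => a; exact: cont_on_ncoord.
have bnc (j : ncell dh) : exists F : set (ncell dh), [/\ finite_set F,
    forall k, F k -> (#|` free k| < #|` free j|)%N &
    forall z, cube_bdry z -> (set0 : set {ptws Y -> R}) (@ncoord R Y dh j z) \/
      exists2 k, F k & ((@ncoord R Y dh k : _ -> {ptws Y -> R}) @` cube) (@ncoord R Y dh j z)].
  by have [F [? ? Fz]] := ncoord_bdry j; exists F; split=> // z /Fz; right.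
have := @cell_extension _ _ _ _ fcont fcomp _ _ Eh {ptws Y -> R} set0
  (ncell dh) (fun j => #|` free j|) (@ncoord R Y dh) (@ptws_hausdorff R Y) closed0
  cnc (@ncoord_inj R Y dh) (fun _ _ _ => id) bnc phi (fun=> x0).
case.
- move=> j; have [o0 [a1 a1o] [y jy]] := ncellP j.
  apply: (@cont_on_eq _ _ _ (fun z => r (barycentre (ones j `|` free j)%fset (@ncoord R Y dh j z)))).
    move=> z _; rewrite /phi (suppE (ones j `|` free j)%fset)// => a.
    exact: nzF (on_face_ncoord z).
  have pos (z : 'rV[R]_(#|` free j|)) a : cube z -> 0 <= ncoord z a.
    by move=> cz; have /andP[] := ncoord01 a cz.
  have nz1 (z : 'rV[R]_(#|` free j|)) : exists a, ncoord z a != 0.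
    by exists a1; rewrite ncoord_one// oner_neq0.
  have nzy (z : 'rV[R]_(#|` free j|)) a : ncoord z a != 0 -> mdist a y < dh a.
    by move=> hz; have := nzF j _ a (on_face_ncoord z) hz; rewrite inE; exact: jy.
  apply: retr_cont.
    apply: supcont_barycentre => [a|z cz]; first exact: cont_on_ncoord.
    have [S0 _] := centre _ _ y (fun a => pos z a cz)
      (fun a => nzF _ _ a (on_face_ncoord z)) (nz1 z) (nzy z).
    by rewrite gt_eqF.
  move=> z cz; apply: (baryU _ _ y) => // [a|a|a]; first exact: pos.
    exact: nzF (on_face_ncoord z).
  exact: nzy.
- by move=> x [].
- by move=> x [].
- by move=> x [].
move=> G [Th [_ GTh]].
have [lam [clam lam01 lamd lam1 lamf]] := metric_bumps dh0.
pose L (y : Y) : {ptws Y -> R} := fun a => lam a y.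
have Lpos y a : 0 <= L y a by have /andP[] := lam01 a y.
have Lnz y a : (L y a != 0) = (0 < lam a y).
  by rewrite lt_neqAle eq_sym; have := Lpos y a; rewrite /L => ->; rewrite andbT.
have Ly y a : L y a != 0 -> mdist a y < dh a by rewrite Lnz; exact: lamd.
have Lex y : exists a, L y a != 0.
  by have [a ay] := lam1 y; exists a; rewrite /L ay oner_neq0.
(* the sets [C j] are closed, and near each point finitely many of them cover
   [Y]; on each of them the map to the nerve is continuous into one face *)
pose C (j : ncell dh) : set Y := [set y | on_face j (L y)].
have cC j : closed (C j).
  have cl (P : Y -> Prop) (v : R) : closed [set y | forall a, P a -> L y a = v].
    rewrite (_ : mkset _ = \bigcap_(a in P) [set y | lam a y = v]).
      apply: closed_bigI => a _; apply: closed_eq_fun; last exact: cont_on_cst.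
      exact: cont_onT.
    by apply/seteqP; split=> y /= H a; exact: H.
  rewrite (_ : C j = [set y | forall a, a \in ones j -> L y a = 1] `&`
     [set y | forall a, (a \notin ones j) /\ (a \notin free j) -> L y a = 0]).
    exact: closedI.
  apply/seteqP; split=> y [H1 H2]; split=> // a; first by case; exact: H2.
  by move=> ? ?; exact: H2.
have loc (y : Y) : exists F : {fset Y}, \forall z \near y, forall a, L z a != 0 -> a \in F.
  have [F finF nF] := lamf y; exists (fset_set F).
  move: nF; apply: filterS => z H a; rewrite Lnz => /H Fa.
  by rewrite in_fset_set//; exact/mem_set.
have cover (F : {fset Y}) y : (forall a, L y a != 0 -> a \in F) ->
    exists2 j : ncell dh, (ones j `|` free j `<=` F)%fset & C j y.
  move=> LF; have [j [j1 j2 _ _]] := own_face (lam01^~ y) LF (lam1 y)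
    (ex_intro _ y (Ly y)).
  by exists j.
pose q (j : ncell dh) (y : Y) := nproj j (L y).
have qE j y : C j y -> ncoord (q j y) = L y by move=> Cy; exact: nprojK.
have qcube j y : cube (q j y) by apply: nproj_cube => a; exact: lam01.
have cq j D : cont_on D (q j).
  by apply: cont_on_row => i; apply: cont_onT; exact: clam.
have cG : continuous (fun y => G (L y)).
  apply/cont_onTE; apply: (@cont_on_glue _ _ _ _ C) => y _.
  have [F nF] := loc y; exists [set j | (ones j `|` free j `<=` F)%fset]; split.
  - exact: ncells_finite.
  - move=> j _; split=> //.
    apply: (@cont_on_eq _ _ _ (fun y => G (ncoord (q j y)))).
      by move=> z [_ Cz]; rewrite qE.
    by apply: (@cont_on_comp _ _ _ _ cube (q j) (fun z => G (ncoord z))) => //; have [] := GTh j.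
  - by move: nF; apply: filterS => z /cover[j ? ?] _; exists j.
exists (fun y => G (L y)) => //.
apply: (@homotopicI_trans _ _ _ (fun y => phi (L y))).
- exists (fun p => Th (L p.1, p.2)); split.
  + apply: (@cont_on_glue _ _ _ _ (fun j => C j `*` setT)) => p _.
    have [F nF] := loc p.1; exists [set j | (ones j `|` free j `<=` F)%fset]; split.
    * exact: ncells_finite.
    * move=> j _; split.
        rewrite (_ : _ `*` _ = fst @^-1` C j).
          by apply: closed_comp => // p' _; exact: cvg_fst.
        by apply/seteqP; split=> p' //= -[].
      apply: (@cont_on_eq _ _ _ (fun p : Y * R => Th (ncoord (q j p.1), p.2))).
        by move=> p' [_ [/= Cp _]]; rewrite qE.
      apply: (@cont_on_comp _ _ _ _ (cube `*` @unit_itv R)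
        (fun p : Y * R => (q j p.1, p.2)) (fun p => Th (ncoord p.1, p.2))) => //.
      - apply: cont_on_pair; last exact: cont_on_snd.
        by apply: (@cont_on_comp _ _ _ _ setT fst (q j)) => //; exact: cont_on_fst.
      - by move=> p' [[_ ?] _]; split=> //; exact: qcube.
      - by have [] := GTh j.
    * have : \forall p' \near p, forall a, L p'.1 a != 0 -> a \in F by exact: (cvg_fst nF).
      by apply: filterS => p' /cover[j ? ?] _; exists j.
  + move=> y; have [F nF] := loc y; have [j _ Cy] := cover F y (nbhs_singleton nF).
    by have [_ _ _ T0] := GTh j; rewrite -(qE j)// T0.
  + move=> y; have [F nF] := loc y; have [j _ Cy] := cover F y (nbhs_singleton nF).
    by have [_ _ T1 _] := GTh j; rewrite -(qE j)// T1.
- exists (fun p => r (fun w => (1 - p.2) * barycentre (supp (L p.1)) (L p.1) w + p.2 * mdist p.1 w)).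
  split.
  + move=> p pD O; have [F nF] := loc p.1.
    have nF' : \forall p' \near p, forall a, L p'.1 a != 0 -> a \in F by exact: (cvg_fst nF).
    pose D := (setT `*` @unit_itv R) `&` [set p' : Y * R | forall a, L p'.1 a != 0 -> a \in F].
    have : cont_on D (fun p => r (fun w => (1 - p.2) * barycentre F (L p.1) w + p.2 * mdist p.1 w)).
      apply: retr_cont; last by move=> p' [[_ t01] LF]; exact: (centreU F (L p'.1) p'.1 p'.2 (Lpos _) LF (Lex _) (Ly _) t01).
      apply: supcont_conv.
      * move=> p' [_ LF]; apply: katetov_barycentre => //.
        by have [] := centre F (L p'.1) p'.1 (Lpos _) LF (Lex _) (Ly _).
      * by move=> p' _; exact: katetov_mdist.
      * apply: supcont_barycentre => [a|p' [_ LF]].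
          apply: (@cont_on_comp _ _ _ _ setT fst (lam a)) => //; first exact: cont_on_fst.
          exact: cont_onT.
        by have [? _] := centre F (L p'.1) p'.1 (Lpos _) LF (Lex _) (Ly _); rewrite gt_eqF.
      * by apply: supcont_mdist; exact: cont_on_fst.
      * exact: cont_on_snd.
    have LF := nbhs_singleton nF'.
    move=> /(_ p (conj pD LF) O); rewrite (suppE F)// => H /H; move: nF'.
    by apply: filterS2 => p' LF' H' ?; rewrite (suppE F)//; apply: H'.
  + move=> y /=; congr r; apply/funext => w; ring.
  + move=> y /=; rewrite -[RHS]rid; congr r; apply/funext => w; ring.
Qed.

End HomotopySection.

(** * Compressive maps are homotopy equivalences *)

Theorem theorem2 (R : realType) (X : topologicalType) (Y : metricType R)
    (f : X -> Y)
    (hXconn : connected [set: X])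
    (hXcw : exists K : topologicalType,
        countable_cw_complex R K /\ homotopy_equivalent R X K)
    (hY : absolute_neighborhood_retract Y)
    (hfcont : continuous f)
    (hfsurj : set_surj [set: X] [set: Y] f)
    (hfcomp : compressive R f) :
  homotopy_equivalence R f.
Proof.
(* a map between empty spaces *)
have [[y0 _]|Y0] := pselect ([set: Y] !=set0); last first.
  have noY (y : Y) : False by apply: Y0; exists y.
  split=> //; exists (fun y => False_rect X (noY y)); split.
  - by move=> y; case: (noY y).
  - apply/homotopicIE; exists fst; split; first exact: cont_on_fst.
      by move=> x; case: (noY (f x)).
    by move=> x; case: (noY (f x)).
  - apply/homotopicIE; exists fst; split; first exact: cont_on_fst.
      by move=> y; case: (noY y).
    by move=> y; case: (noY y).
have [g cg fg1] := homotopy_section y0 hY hfcont hfcomp.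
have [K [[c _] [al [cal [be [cbe /homotopicIE beal _]]]]]] := hXcw.
split=> //; exists g; split=> //; apply/homotopicIE; last exact: fg1.
have cgf : continuous (fun x => g (f x)).
  by move=> x; apply: continuous_comp; [exact: hfcont|exact: cg].
have cgfb : continuous (fun k => g (f (be k))).
  by move=> k; apply: (@continuous_comp _ _ _ be (fun x => g (f x))); [exact: cbe|exact: cgf].
have cfb : continuous (fun k => f (be k)).
  by move=> k; apply: continuous_comp; [exact: cbe|exact: hfcont].
have /homotopicIE gfb : homotopic R (fun k => g (f (be k))) be.
  apply: (homotopic_lift c y0 hY hfcont hfcomp cgfb cbe).
  by apply/homotopicIE; exact: homotopicI_precomp cfb fg1.
apply: (@homotopicI_trans _ _ _ (fun x => g (f (be (al x))))).
  apply: homotopicI_sym.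
  exact: (homotopicI_postcomp cgf beal).
apply: (@homotopicI_trans _ _ _ (fun x => be (al x))); last exact: beal.
exact: (homotopicI_precomp cal gfb).
Qed.
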